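(* Let $p\in(0,1)$, $q_1=(1-\sqrt{1-p})/2$ and $q_2=1-q_1$. For $q\in(0,1)$, $\sigma>0$, $\mu\in\mathbb{R}$ put $$a_q(\sigma)=\hat\mu+\frac{\sigma\ln q}{n},\qquad \sigma_q=\frac{2m\hat\sigma}{\chi^2_q(2m-2)},\qquad b_q(\mu)=\frac{2(n(\hat\mu-\mu)+m\hat\sigma)}{\chi^2_q(2m)},\qquad \mu_q=\hat\mu-\frac{m\hat\sigma\,\mathrm{F}_q(2,2m-2)}{(m-1)n},$$ and define the confidence regions $$C_1=\{(\mu,\sigma)\in\Theta:\ a_{q_1}(\sigma)\le\mu\le a_{q_2}(\sigma),\ \sigma_{q_2}\le\sigma\le\sigma_{q_1}\},$$ $$C_2=\{(\mu,\sigma)\in\Theta:\ \mu_{q_2}\le\mu\le\mu_{q_1},\ b_{q_2}(\mu)\le\sigma\le b_{q_1}(\mu)\}.$$ Then, for $i=1,2$, the set $B_i=\bigcup_{\tilde\vartheta\in C_i}\mathrm{graph}\,F_{\tilde\vartheta}$ satisfies $$B_i=\{(x,y)\in\mathbb{R}\times[0,1]:\ U_i(x)\le y\le O_i(x)\},$$ where $$U_1(x)=\begin{cases}F_{(a_{q_2}(\sigma_{q_2}),\sigma_{q_2})}(x),&x\le\hat\mu\\ F_{(a_{q_2}(\sigma_{q_1}),\sigma_{q_1})}(x),&x>\hat\mu\end{cases},\qquad O_1(x)=\begin{cases}F_{(a_{q_1}(\sigma_{q_1}),\sigma_{q_1})}(x),&x\le\hat\mu\\ F_{(a_{q_1}(\sigma_{q_2}),\sigma_{q_2})}(x),&x>\hat\mu\end{cases},$$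 $$U_2(x)=\begin{cases}F_{(\mu_{q_1},b_{q_1}(\mu_{q_1}))}(x),&x\le\hat\mu+m\hat\sigma/n\\ F_{(\mu_{q_2},b_{q_1}(\mu_{q_2}))}(x),&x>\hat\mu+m\hat\sigma/n\end{cases},\qquad O_2(x)=\begin{cases}F_{(\mu_{q_2},b_{q_2}(\mu_{q_2}))}(x),&x\le\hat\mu+m\hat\sigma/n\\ F_{(\mu_{q_1},b_{q_2}(\mu_{q_1}))}(x),&x>\hat\mu+m\hat\sigma/n\end{cases},$$ and $B_1$, $B_2$ are confidence bands for $F_\vartheta$ with exact confidence level $1-p$.
   Context: Let $1<m\le n$ be integers and $(R_1,\dots,R_m)\in\mathbb{N}_0^m$ with $\sum_{j=1}^mR_j=n-m$; set $\gamma_j=\sum_{i=j}^m(R_i+1)$. A sample of progressively type-II censored order statistics $X=(X_{1:m:n},\dots,X_{m:m:n})$ from an absolutely continuous cdf $F$ with density $f$ has joint density $\prod_{j=1}^m\gamma_jf(x_j)[1-F(x_j)]^{R_j}$ on $x_1\le\dots\le x_m$. Here $F=F_\vartheta$ belongs to the exponential location-scale family: for $\vartheta=(\mu,\sigma)\in\Theta=\mathbb{R}\times(0,\infty)$, $F_\vartheta(x)=1-\exp\{-(x-\mu)/\sigma\}$ for $x>\mu$ and $F_\vartheta(x)=0$ for $x\le\mu$; $\vartheta$ is unknown and $P_\vartheta$ denotes the underlying probability. The MLEs are $\hat\mu=X_{1:m:n}$ and $\hat\sigma=\frac1m\sum_{j=2}^m\gamma_j(X_{j:m:n}-X_{j-1:m:n})$.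 $\chi^2_\beta(k)$ and $\mathrm{F}_\beta(k_1,k_2)$ denote the $\beta$-quantiles of the chi-square distribution with $k$ degrees of freedom and the F-distribution with $(k_1,k_2)$ degrees of freedom. $\mathrm{graph}\,F=\{(t,F(t)):t\in\mathbb{R}\}$. A confidence band is a random subset $B=B(X)$ of $\mathbb{R}^2$ such that $\{\mathrm{graph}\,F_\vartheta\subseteq B\}$ is measurable and the vertical sections $\{y:(t,y)\in B\}$ are a.s. intervals; it has exact confidence level $1-p$ if $P_\vartheta(\mathrm{graph}\,F_\vartheta\subseteq B)=1-p$ for all $\vartheta\in\Theta$. *)

(* Defs.v *)
From HB Require Import structures.
From mathcomp Require Import all_boot all_order all_algebra.
From mathcomp Require Import all_classical all_reals all_analysis.
Set Implicit Arguments. Unset Strict Implicit. Unset Printing Implicit Defensive.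
Import Order.TTheory GRing.Theory Num.Theory.
Import numFieldNormedType.Exports.
Local Open Scope classical_set_scope.
Local Open Scope ring_scope.

Section PCOS.
Variable R : realType.

Definition Theta : set (R * R) := [set th | 0 < th.2].

Definition expF (th : R * R) (t : R) : R :=
  if th.1 < t then 1 - expR (- (t - th.1) / th.2) else 0.

Definition expf (th : R * R) (t : R) : R :=
  if th.1 < t then expR (- (t - th.1) / th.2) / th.2 else 0.

Definition graph (F : R -> R) : set (R * R) := [set tf | tf.2 = F tf.1].

(* Indices are 0-based: Rs j, j < m, is R_{j+1} of the paper and
   gam m Rs j is gamma_{j+1} = sum_{i=j}^{m-1} (Rs i + 1). *)
Definition gam (m : nat) (Rs : nat -> nat) (j : nat) : R :=
  (\sum_(j <= i < m) (Rs i).+1)%N%:R.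

(* joint density of (X_{1:m:n},...,X_{m:m:n}) on x_1 <= ... <= x_m *)
Definition pc_density (m : nat) (Rs : nat -> nat) (th : R * R)
  (x : m.-tuple R) : R :=
  if sorted <=%R x then
    \prod_(j < m) (gam m Rs j * expf th (tnth x j) * (1 - expF th (tnth x j)) ^+ Rs j)
  else 0.

Fixpoint iint (k : nat) : (k.-tuple R -> \bar R) -> \bar R :=
  match k return (k.-tuple R -> \bar R) -> \bar R with
  | 0 => fun g => g [tuple]
  | k'.+1 => fun g =>
      (\int[@lebesgue_measure R]_(t in setT) iint (fun xs => g (cons_tuple t xs)))%E
  end.

Definition pc_prob (m : nat) (Rs : nat -> nat) (th : R * R)
  (E : set (m.-tuple R)) : \bar R :=
  iint (fun x => ((\1_E x) * pc_density Rs th x)%:E).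

(* MLEs *)
Definition hmu (m : nat) (x : m.-tuple R) : R := nth 0 x 0.
Definition hsig (m : nat) (Rs : nat -> nat) (x : m.-tuple R) : R :=
  m%:R^-1 * \sum_(1 <= j < m) gam m Rs j * (nth 0 x j - nth 0 x j.-1).

Definition chi2_udens (k : nat) (t : R) : R :=
  if 0 < t then powR t (k%:R / 2 - 1) * expR (- t / 2) else 0.
Definition Fdist_udens (k1 k2 : nat) (t : R) : R :=
  if 0 < t then powR t (k1%:R / 2 - 1) *
                powR (1 + k1%:R * t / k2%:R) (- (k1%:R + k2%:R) / 2)
  else 0.
Definition cdf_of (g : R -> R) (x : R) : R :=
  fine (\int[@lebesgue_measure R]_(t in `]-oo, x]) (g t)%:E)%E /
  fine (\int[@lebesgue_measure R]_(t in setT) (g t)%:E)%E.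
Definition quantile (g : R -> R) (beta : R) : R := inf [set x | beta <= cdf_of g x].
Definition chi2q (k : nat) (beta : R) : R := quantile (chi2_udens k) beta.
Definition Fq (k1 k2 : nat) (beta : R) : R := quantile (Fdist_udens k1 k2) beta.

Section Band.
Variables (n m : nat) (Rs : nat -> nat) (x : m.-tuple R).
Let mu_hat := hmu x.
Let sig_hat := hsig Rs x.

Definition a_q (q sigma : R) : R := mu_hat + sigma * ln q / n%:R.
Definition sig_q (q : R) : R := 2 * m%:R * sig_hat / chi2q (2 * m - 2) q.
Definition b_q (q mu : R) : R :=
  2 * (n%:R * (mu_hat - mu) + m%:R * sig_hat) / chi2q (2 * m) q.
Definition mu_q (q : R) : R :=
  mu_hat - m%:R * sig_hat * Fq 2 (2 * m - 2) q / ((m%:R - 1) * n%:R).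

Definition C1 (q1 q2 : R) : set (R * R) :=
  [set th | Theta th /\ a_q q1 th.2 <= th.1 <= a_q q2 th.2 /\
            sig_q q2 <= th.2 <= sig_q q1].
Definition C2 (q1 q2 : R) : set (R * R) :=
  [set th | Theta th /\ mu_q q2 <= th.1 <= mu_q q1 /\
            b_q q2 th.1 <= th.2 <= b_q q1 th.1].

Definition U1 (q1 q2 : R) (t : R) : R :=
  if t <= mu_hat then expF (a_q q2 (sig_q q2), sig_q q2) t
  else expF (a_q q2 (sig_q q1), sig_q q1) t.
Definition O1 (q1 q2 : R) (t : R) : R :=
  if t <= mu_hat then expF (a_q q1 (sig_q q1), sig_q q1) t
  else expF (a_q q1 (sig_q q2), sig_q q2) t.
Definition U2 (q1 q2 : R) (t : R) : R :=
  if t <= mu_hat + m%:R * sig_hat / n%:R then expF (mu_q q1, b_q q1 (mu_q q1)) t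
  else expF (mu_q q2, b_q q1 (mu_q q2)) t.
Definition O2 (q1 q2 : R) (t : R) : R :=
  if t <= mu_hat + m%:R * sig_hat / n%:R then expF (mu_q q2, b_q q2 (mu_q q2)) t
  else expF (mu_q q1, b_q q2 (mu_q q1)) t.
End Band.

Definition band_of (C : set (R * R)) : set (R * R) :=
  \bigcup_(th in C) graph (expF th).

Definition between (U O : R -> R) : set (R * R) :=
  [set xy | 0 <= xy.2 <= 1 /\ U xy.1 <= xy.2 <= O xy.1].

Definition exact_conf_band (m : nat) (Rs : nat -> nat)
  (B : m.-tuple R -> set (R * R)) (lvl : R) : Prop :=
  forall th, Theta th ->
    measurable [set x : m.-tuple R | graph (expF th) `<=` B x] /\
    (exists N : set (m.-tuple R), measurable N /\ pc_prob Rs th N = 0%E /\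
       forall x, ~ N x -> forall t, is_interval [set y | B x (t, y)]) /\
    pc_prob Rs th [set x | graph (expF th) `<=` B x] = lvl%:E.

End PCOS.

(* Main.v *)
Require Import Defs.
From HB Require Import structures.
From mathcomp Require Import all_boot all_order all_algebra.
From mathcomp Require Import all_classical all_reals all_analysis.
From mathcomp Require Import measurable_realfun ring lra.
Import Order.TTheory GRing.Theory Num.Theory.
Import numFieldNormedType.Exports.
Local Open Scope classical_set_scope.
Local Open Scope ring_scope.
Set Implicit Arguments.
Unset Strict Implicit.
Unset Printing Implicit Defensive.

(* Both C_1 and C_2 are trapezoids in Theta, cut out by two parallel lines and
   by two lines that meet at (hmu, 0) for C_1 and at (hmu + m hsig / n, 0) for
   C_2.  On a convex set of parameters, F_th t is
   monotone in the function (t - mu)/sigma, so at each t its extrema sit at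
   vertices, and the values in between are reached on the segment joining the
   two extremal vertices.  Conversely a graph contained in the band has its
   parameter in C_i, so coverage is the event {th in C_i}.

   The normalized spacings gamma_j (X_j - X_(j-1)) / sigma are independent
   standard exponentials.  Hence u = n (hmu - mu) / sigma is Exp(1) and
   s = m hsig / sigma is an independent Gamma(m-1), and {th in C_i} is a region
   in the (u, s)-plane: a rectangle for C_1, and for C_2 the product of an
   interval for u/s and an interval for u + s, which are independent too. *)

(** * Trapezoids of parameters and their bands *)

Section Geometry.
Variable R : realType.
Implicit Types (th : R * R) (C : set (R * R)) (t y : R).

(** Cross-multiplied comparison of [(t - th.1) / th.2] with [(t - th'.1) / th'.2]. For [t <= th.1]
    the left value is 0 and nothing is required. For [th.1 < t <= th'.1] the signs refute the
    product inequality, so no premise on [th'.1] appears. *)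
Lemma expF_le th th' t : Theta th -> Theta th' ->
  (expF th t <= expF th' t) =
  (th.1 < t) ==> ((t - th.1) * th'.2 <= (t - th'.1) * th.2).
Proof.
rewrite /Theta /expF /= => s0 s'0.
case: (ltP th.1 t) => /= [mt|_].
  case: (ltP th'.1 t) => /= [mt'|mt'].
    rewrite lerD2l lerN2 ler_expR !mulNr lerN2.
    by rewrite ler_pdivrMr// mulrAC ler_pdivlMr.
  apply/esym; apply: (@etrans _ _ false).
    apply/negbTE; rewrite -ltNge.
    apply: (@le_lt_trans _ _ 0).
      by rewrite mulr_le0_ge0 ?subr_le0// ltW.
    by rewrite mulr_gt0 ?subr_gt0.
  apply/esym/negbTE; rewrite -ltNge subr_gt0 -expR0 ltr_expR.
  by rewrite mulNr oppr_lt0 divr_gt0 ?subr_gt0.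
case: ifP => // [mt'|_]; last by rewrite lexx.
by rewrite subr_ge0 -expR0 ler_expR mulNr oppr_le0 divr_ge0 ?subr_ge0 ?ltW.
Qed.

Lemma expF_itv th t : Theta th -> 0 <= expF th t < 1.
Proof.
rewrite /Theta /expF /= => s0; case: ifP => [mt|_]; last by rewrite lexx ltr01.
rewrite subr_ge0 ltrBlDr ltrDl expR_gt0 andbT -expR0 ler_expR mulNr oppr_le0.
by rewrite divr_ge0 ?subr_ge0// ltW.
Qed.

(** Abstract form of the vertex argument: [U] and [O] are attained bounds, and convexity of [C]
    fills the vertical section between them. *)
Lemma band_of_between C (U O : R -> R) :
  C `<=` @Theta R ->
  (forall th th' s, C th -> C th' -> 0 <= s <= 1 ->
     C ((1 - s) * th.1 + s * th'.1, (1 - s) * th.2 + s * th'.2)) ->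
  (forall t, exists2 th, C th & U t = expF th t) ->
  (forall t, exists2 th, C th & O t = expF th t) ->
  (forall th t, C th -> U t <= expF th t <= O t) ->
  band_of C = between U O.
Proof.
move=> CT Ccvx UC OC UO; apply/seteqP; split=> [[t y] [th Cth]|[t y]].
  rewrite /graph /= => ->; split; last exact: UO.
  by have /andP[-> /ltW ->] := expF_itv t (CT _ Cth).
rewrite /between /= => -[/andP[y0 _]] /andP[Uy yO].
have [u Cu uE] := UC t; have [v Cv vE] := OC t.
(* The level 0 is special: [expF th t = 0] holds on the half-plane [t <= th.1] and not on a line.
   Here the minimiser [u] itself has the value 0. *)
have [y00|yn0] := eqVneq y 0.
  exists u => //; apply/eqP; rewrite /= eq_le -{2}uE Uy andbT y00.
  by have /andP[->] := expF_itv t (CT _ Cu).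
have yp : 0 < y by rewrite lt_neqAle eq_sym yn0.
have y1 : y < 1.
  by rewrite (le_lt_trans yO)// vE; have /andP[] := expF_itv t (CT _ Cv).
(* [w] is the standard exponential quantile of level [y], so the value [y] is taken exactly when
   [(t - th.1) / th.2 = w]. *)
pose w := - ln (1 - y).
have wE : expR (- w) = 1 - y by rewrite opprK lnK// posrE subr_gt0.
have w0 : 0 < w by rewrite /w oppr_gt0 -ln1 ltr_ln ?posrE ?subr_gt0//; lra.
have yF th : Theta th -> t - th.1 = w * th.2 -> y = expF th t.
  move=> Tth E; rewrite /expF -subr_gt0 E mulr_gt0//.
  by rewrite mulNr mulfK ?gt_eqF// wE subKr.
(* F_th t = y iff k th = 0, and k is affine, so a zero of k is found on the
   segment from u to v. *)
pose k th := t - th.1 - w * th.2.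
have ku : k u <= 0.
  move: Uy; rewrite uE /expF /k; case: (ltP u.1 t) => [ut|ut _].
    rewrite lerBlDl addrC -lerBlDl -wE ler_expR mulNr lerN2.
    by rewrite ler_pdivrMr ?subr_le0//; exact: (CT _ Cu).
  have := CT _ Cu; rewrite /Theta/= => u0.
  by rewrite subr_le0 (@le_trans _ _ 0) ?subr_le0// mulr_ge0// ltW.
have kv : 0 <= k v.
  move: yO; rewrite vE /expF /k; case: (ltP v.1 t) => [vt|vt]; last first.
    by rewrite leNgt yp.
  rewrite lerBrDl addrC -lerBrDl -wE ler_expR mulNr lerN2.
  by rewrite ler_pdivlMr ?subr_ge0//; exact: (CT _ Cv).
(* As [k u <= 0 <= k v], equality makes both vanish; otherwise linear interpolation gives the weight
   [s] of the zero. *)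
have [kuv|kuv] := eqVneq (k u) (k v).
  exists u => //=; apply: yF; first exact: CT.
  by apply/eqP; rewrite -subr_eq0 -/(k u); lra.
pose s := - k u / (k v - k u).
have d0 : 0 < k v - k u.
  by rewrite subr_gt0 lt_neqAle kuv (le_trans ku).
have s01 : 0 <= s <= 1.
  by rewrite /s divr_ge0 ?oppr_ge0 ?(ltW d0)//= ler_pdivrMr// mul1r lerDr.
have Cs := Ccvx _ _ s Cu Cv s01.
eexists; first exact: Cs.
apply: yF; first exact: CT.
apply/eqP; rewrite -subr_eq0 /=.
have -> : t - ((1 - s) * u.1 + s * v.1) - w * ((1 - s) * u.2 + s * v.2) =
  k u + s * (k v - k u) by rewrite /k; ring.
have -> : s * (k v - k u) = - k u by rewrite /s divfK// gt_eqF.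
by rewrite addrN.
Qed.

Lemma graph_between (U O : R -> R) th :
  graph (expF th) `<=` between U O ->
  forall t, U t <= expF th t /\ expF th t <= O t.
Proof. by move=> sub t; have [_ /andP[]] := sub (t, expF th t) erefl. Qed.

Lemma conv_le (s x y x' y' : R) : 0 <= s <= 1 -> x <= x' -> y <= y' ->
  (1 - s) * x + s * y <= (1 - s) * x' + s * y'.
Proof.
move=> /andP[s0 s1] xx yy.
by rewrite lerD// ler_wpM2l// subr_ge0.
Qed.

Lemma conv_gt0 (s x y : R) : 0 <= s <= 1 -> 0 < x -> 0 < y ->
  0 < (1 - s) * x + s * y.
Proof. by move=> /andP[s0 s1] x0 y0; nra. Qed.

(** On the line [th.1 = h - l * th.2] one has [(t - th.1) / th.2 = (t - h) / th.2 + l], monotone in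
    [th.2] with a direction given by the sign of [t - h]; hence the change of vertex at [h].
    Conversely, the graph at [t = h] bounds [(h - th.1) / th.2], and its behaviour for large [t]
    bounds [th.2]. *)
Lemma trapezoid1 (h l1 l2 s1 s2 : R) (a1 a2 : R -> R) :
  (forall s, a1 s = h - l1 * s) -> (forall s, a2 s = h - l2 * s) ->
  0 < l2 -> l2 < l1 -> 0 < s2 -> s2 < s1 ->
  let C := [set th | Theta th /\ a1 th.2 <= th.1 <= a2 th.2 /\
              s2 <= th.2 <= s1] in
  let U t := if t <= h then expF (a2 s2, s2) t else expF (a2 s1, s1) t in
  let O t := if t <= h then expF (a1 s1, s1) t else expF (a1 s2, s2) t in
  band_of C = between U O /\
  forall th, Theta th -> graph (expF th) `<=` between U O -> C th.
Proof.
move=> a1E a2E l20 l21 s20 s21 C U O.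
have s10 := lt_trans s20 s21; have l10 := lt_trans l20 l21.
have Cv (l s : R) a : (forall s, a s = h - l * s) -> l2 <= l <= l1 ->
    s2 <= s <= s1 -> C (a s, s).
  move=> aE /andP[l2l ll1] /andP[s2s ss1].
  have s0 := lt_le_trans s20 s2s.
  rewrite /C /Theta /= aE a1E a2E s2s ss1 !lerD2l !lerN2; split=> //; split=> //.
  by rewrite !ler_pM2r// l2l ll1.
have c1 s := Cv l1 s a1 a1E; have c2 s := Cv l2 s a2 a2E.
rewrite !lexx (ltW l21) /= in c1 c2.
have {}c1 s := c1 s isT; have {}c2 s := c2 s isT.
have cs1 : s2 <= s1 <= s1 by rewrite lexx ltW.
have cs2 : s2 <= s2 <= s1 by rewrite lexx ltW.
split.
  apply: band_of_between.
  - by move=> th [].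
  - move=> [u1 u2] [v1 v2] s [Tu [/andP[+ +] /andP[+ +]]] [Tv [/andP[+ +] /andP[+ +]]].
    move: Tu Tv; rewrite /Theta /C /= !a1E !a2E => Tu Tv u_1 u_2 u_3 u_4 v_1 v_2 v_3 v_4.
    move=> s01; split; first exact: conv_gt0.
    have := (conv_le s01 u_1 v_1, conv_le s01 u_2 v_2, conv_le s01 u_3 v_3,
      conv_le s01 u_4 v_4) => -[[[? ?] ?] ?].
    by split; apply/andP; split; lra.
  - move=> t; rewrite /U; case: ifP => _; [exists (a2 s2, s2)|exists (a2 s1, s1)] => //;
    exact: c2.
  - move=> t; rewrite /O; case: ifP => _; [exists (a1 s1, s1)|exists (a1 s2, s2)] => //;
    exact: c1.
  - move=> [mu s] t [Ts [/andP[+ +] /andP[+ +]]].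
    rewrite /U /O/= a1E a2E => mu1 mu2 s2s ss1.
    have s0 : 0 < s by [].
    case: (leP t h) => th; rewrite !expF_le//= !a1E !a2E; apply/andP; split;
      apply/implyP => ?; nra.
move=> [mu s] Ts sub; have {}sub := graph_between sub.
have s0 : 0 < s by [].
have [] := sub h; rewrite /U /O lexx !expF_le//= !a1E !a2E.
have -> : h - l2 * s2 < h by rewrite ltrBlDr ltrDl mulr_gt0.
move=> /= h1 /implyP h2.
have mu2 : mu <= h - l2 * s by nra.
have /h2 {}h2 : mu < h by nra.
have mu1 : h - l1 * s <= mu by nra.
split=> //=; split; first by rewrite a1E a2E mu1.
apply/andP; split; rewrite leNgt; apply/negP => ss.
  (* For [s < s2] the standardised line of [(mu, s)] is steeper than that of the vertex
     [(a1 s2, s2)]. The quotient is the abscissa of their crossing, and one unit further the graph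
     lies above [O]. *)
  pose t := Num.max (h + 1) ((mu * s2 - h * s + l1 * s2 * s) / (s2 - s) + 1).
  have ht : h < t by rewrite lt_max ltrDl ltr01.
  have [_] := sub t; rewrite /U /O (leNgt t h) ht /= expF_le//= a1E => /implyP.
  have : mu < t by nra.
  move=> /[swap] /[apply].
  have : (mu * s2 - h * s + l1 * s2 * s) / (s2 - s) + 1 <= t by rewrite le_max lexx orbT.
  have d0 : 0 < s2 - s by rewrite subr_gt0.
  by rewrite -lerBrDr ler_pdivrMr//; nra.
(* Symmetric choice: beyond the crossing with the line of [(a2 s1, s1)], the flatter line of
   [(mu, s)] falls below [U]. *)
pose t := Num.max (h + 1) ((h * s - mu * s1 - l2 * s1 * s) / (s - s1) + 1).
have ht : h < t by rewrite lt_max ltrDl ltr01.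
have [+ _] := sub t; rewrite /U /O (leNgt t h) ht /= expF_le//= a2E => /implyP.
have : h - l2 * s1 < t by nra.
move=> /[swap] /[apply].
have : (h * s - mu * s1 - l2 * s1 * s) / (s - s1) + 1 <= t by rewrite le_max lexx orbT.
have d0 : 0 < s - s1 by rewrite subr_gt0.
by rewrite -lerBrDr ler_pdivrMr//; nra.
Qed.

(** The sides [b1] and [b2] meet at [(c, 0)]. Conversely, the graph at [t = c] bounds
    [th.2 / (c - th.1)]. A location below [m2] is excluded at [t = m2], where [O] vanishes, and one
    above [m1] at [t = th.1], where the graph vanishes but [U] does not. *)
Lemma trapezoid2 (c k1 k2 m1 m2 : R) (b1 b2 : R -> R) :
  (forall mu, b1 mu = k1 * (c - mu)) -> (forall mu, b2 mu = k2 * (c - mu)) ->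
  0 < k2 -> k2 < k1 -> m2 < m1 -> m1 < c ->
  let C := [set th | Theta th /\ m2 <= th.1 <= m1 /\
              b2 th.1 <= th.2 <= b1 th.1] in
  let U t := if t <= c then expF (m1, b1 m1) t else expF (m2, b1 m2) t in
  let O t := if t <= c then expF (m2, b2 m2) t else expF (m1, b2 m1) t in
  band_of C = between U O /\
  forall th, Theta th -> graph (expF th) `<=` between U O -> C th.
Proof.
move=> b1E b2E k20 k21 m21 m1c C U O.
have m2c := lt_trans m21 m1c; have k10 := lt_trans k20 k21.
have Cv (m k : R) b : (forall m, b m = k * (c - m)) -> k2 <= k <= k1 ->
    m2 <= m <= m1 -> C (m, b m).
  move=> bE /andP[k2k kk1] /andP[m2m mm1].
  have cm : 0 < c - m by rewrite subr_gt0 (le_lt_trans mm1).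
  rewrite /C /Theta /= bE b1E b2E m2m mm1 !ler_pM2r// k2k kk1; split=> //.
  by rewrite mulr_gt0// (lt_le_trans k20).
have c1 m := Cv m k1 b1 b1E; have c2 m := Cv m k2 b2 b2E.
rewrite !lexx (ltW k21) /= in c1 c2.
have {}c1 m := c1 m isT; have {}c2 m := c2 m isT.
have cm1 : m2 <= m1 <= m1 by rewrite lexx ltW.
have cm2 : m2 <= m2 <= m1 by rewrite lexx ltW.
have T1 m : m < c -> Theta (m, b1 m) by move=> mc; rewrite /Theta/= b1E mulr_gt0 ?subr_gt0.
have T2 m : m < c -> Theta (m, b2 m) by move=> mc; rewrite /Theta/= b2E mulr_gt0 ?subr_gt0.
have [? ? ? ?] := And4 (T1 _ m1c) (T1 _ m2c) (T2 _ m1c) (T2 _ m2c).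
split.
  apply: band_of_between.
  - by move=> th [].
  - move=> [u1 u2] [v1 v2] s [Tu [/andP[+ +] /andP[+ +]]] [Tv [/andP[+ +] /andP[+ +]]].
    move: Tu Tv; rewrite /Theta /C /= !b1E !b2E => Tu Tv u_1 u_2 u_3 u_4 v_1 v_2 v_3 v_4.
    move=> s01; split; first exact: conv_gt0.
    have := (conv_le s01 u_1 v_1, conv_le s01 u_2 v_2, conv_le s01 u_3 v_3,
      conv_le s01 u_4 v_4) => -[[[? ?] ?] ?].
    by split; apply/andP; split; lra.
  - move=> t; rewrite /U; case: ifP => _; [exists (m1, b1 m1)|exists (m2, b1 m2)] => //;
    exact: c1.
  - move=> t; rewrite /O; case: ifP => _; [exists (m2, b2 m2)|exists (m1, b2 m1)] => //;
    exact: c2.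
  - move=> [mu s] t [Ts [/andP[+ +] /andP[+ +]]].
    rewrite /U /O/= b1E b2E => mu2 mu1 s2s ss1.
    have s0 : 0 < s by [].
    have muc : mu < c by exact: le_lt_trans m1c.
    (* Up to a positive factor, the standardised value on a line through [(c, 0)] is
       [(t - x) / (c - x)]. The identity shows it to be decreasing in [x] for [t < c] and increasing
       for [t > c]. *)
    have key (x y : R) : (c - t) * (y - x) = (t - x) * (c - y) - (t - y) * (c - x) by ring.
    have {}mu2 : 0 <= mu - m2 by rewrite subr_ge0.
    have {}mu1 : 0 <= m1 - mu by rewrite subr_ge0.
    case: (leP t c) => tc; rewrite !expF_le//= !b1E !b2E; apply/andP; split;
      apply/implyP => ?.
    + apply: (@le_trans _ _ ((t - m1) * (k1 * (c - mu)))).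
        by rewrite ler_pM2l ?subr_gt0.
      rewrite mulrCA [leRHS]mulrCA ler_pM2l// -subr_ge0 -key mulr_ge0// subr_ge0//.
    + apply: (@le_trans _ _ ((t - m2) * (k2 * (c - mu)))); last first.
        by rewrite ler_wpM2l// subr_ge0; lra.
      rewrite mulrCA [leRHS]mulrCA ler_pM2l// -subr_ge0 -key mulr_ge0// subr_ge0//.
    + apply: (@le_trans _ _ ((t - m2) * (k1 * (c - mu)))).
        by rewrite ler_pM2l ?subr_gt0.
      have tc' : 0 < t - c by rewrite subr_gt0.
      rewrite mulrCA [leRHS]mulrCA ler_pM2l// -subr_ge0 -key; nra.
    + apply: (@le_trans _ _ ((t - m1) * (k2 * (c - mu)))); last first.
        by rewrite ler_wpM2l// subr_ge0; lra.
      have tc' : 0 < t - c by rewrite subr_gt0.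
      rewrite mulrCA [leRHS]mulrCA ler_pM2l// -subr_ge0 -key; nra.
move=> [mu s] Ts sub; have {}sub := graph_between sub.
have s0 : 0 < s by [].
have [] := sub c; rewrite /U /O lexx !expF_le//= !b1E !b2E m1c /=.
have c1p : 0 < c - m1 by rewrite subr_gt0.
have c2p : 0 < c - m2 by rewrite subr_gt0.
move=> h1 /implyP h2.
have sk1 : s <= k1 * (c - mu) by nra.
have muc : mu < c by nra.
have sk2 : k2 * (c - mu) <= s by have := h2 muc; nra.
split=> //=; split; last by rewrite b1E b2E sk1 sk2.
apply/andP; split; rewrite leNgt; apply/negP => mm.
  have [_] := sub m2; rewrite /U /O (ltW m2c) expF_le//= mm /= subrr mul0r b2E.
  by rewrite leNgt !mulr_gt0// subr_gt0.
have [+ _] := sub mu; rewrite /U /O (ltW muc) expF_le//= mm /= subrr mul0r.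
by rewrite leNgt !mulr_gt0// subr_gt0.
Qed.

End Geometry.

(** * Integrals and quantiles *)

Section AffineSubstitution.
Variable R : realType.
Local Notation leb := (@lebesgue_measure R).
Local Open Scope ereal_scope.

Lemma measurable_affine (a b : R) :
  measurable_fun [set: measurableTypeR R]
    ((fun t => a * t + b)%R : measurableTypeR R -> measurableTypeR R).
Proof. by apply: measurable_funD => //; exact: mulrl_measurable. Qed.

(** The pushforward of Lebesgue measure under [a * t + b], scaled by [a], agrees with Lebesgue
    measure on half-open intervals, hence everywhere. Thus [f] need only be measurable and
    nonnegative. *)
Lemma integral_affine (f : R -> \bar R) (a b : R) : (0 < a)%R ->
  measurable_fun setT f -> (forall x, 0 <= f x) ->
  \int[leb]_x f x = a%:E * \int[leb]_x f (a * x + b)%R.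
Proof.
move=> a0 mf f0.
pose phi : measurableTypeR R -> measurableTypeR R := (fun t => a * t + b)%R.
have mphi : measurable_fun setT phi := @measurable_affine a b.
pose nu := measure_function_pushforward__canonical__measure_function_Measure
  leb mphi.
transitivity (\int[mscale (NngNum (ltW a0)) nu]_x f x).
  apply: eq_measure_integral => A mA _.
  apply: lebesgue_measure_unique => // _ [[c d] _ <-] /=.
  rewrite /mscale/= /pushforward /=.
  have -> : (phi @^-1` `]c, d] = `](c - b) / a, (d - b) / a])%classic%R.
    apply/seteqP; split=> x /=; rewrite !in_itv/= /phi ltr_pdivrMr// ler_pdivlMr//;
    by rewrite ltrBlDr lerBrDr mulrC.
  rewrite !lebesgue_measure_itv/= !lte_fin ltr_pM2r ?invr_gt0// ltrD2r.
  case: ifP => _; last by rewrite mule0.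
  by rewrite -!EFinD -EFinM; congr EFin; field; rewrite gt_eqF.
rewrite ge0_integral_mscale//.
congr (_ * _); rewrite ge0_integral_pushforward//.
Qed.

End AffineSubstitution.

Section Calculus.
Variable R : realType.
Local Notation leb := (@lebesgue_measure R).
Implicit Types (F f g G : R -> R) (a b c x : R).

Lemma is_derive_continuous F x d : is_derive x 1 F d -> {for x, continuous F}.
Proof. by move=> dF; apply: differentiable_continuous; apply/derivable1_diffP; case: dF. Qed.

Lemma integral_is_derive F f a b : a <= b ->
  (forall x, a <= x <= b -> is_derive x 1 F (f x)) ->
  (forall x, a <= x <= b -> {for x, continuous f}) ->
  (\int[leb]_(x in `[a, b]) (f x)%:E)%E = (F b - F a)%:E.
Proof.
rewrite le_eqVlt => /predU1P[<- _ _|ab dF cf].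
  by rewrite set_itv1 integral_set1 subrr.
have cF x : a <= x <= b -> {for x, continuous F}.
  by move=> xab; exact: is_derive_continuous (dF x xab).
rewrite EFinB; apply: continuous_FTC2 => //.
- by apply: continuous_in_subspaceT => x; rewrite inE /= in_itv/= => /cf.
- split.
  + move=> x; rewrite in_itv/= => /andP[ax xb].
    have xab : a <= x <= b by rewrite !ltW.
    by case: (dF _ xab).
  + by apply: cvg_at_right_filter; apply: cF; rewrite lexx ltW.
  + by apply: cvg_at_left_filter; apply: cF; rewrite lexx ltW.
- move=> x; rewrite in_itv/= => /andP[ax xb].
  have xab : a <= x <= b by rewrite !ltW.
  by rewrite derive1E; case: (dF _ xab).
Qed.

Lemma integral_itv_if (i : interval R) (f : R -> \bar R) :
  (\int[leb]_(x in [set` i]) f x = \int[leb]_x if x \in i then f x else 0)%E.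
Proof.
rewrite integral_mkcond; apply: eq_integral => x _.
by rewrite patchE mem_setE.
Qed.

Section Quantile.
(** Roles: [u] is an unnormalised density of total mass [c] on the positive half-line, [g] its
    normalised version, continuous up to 0, and [G] the cdf there. *)
Variables (u g G : R -> R) (c : R).
Hypothesis c0 : 0 < c.
Hypothesis u0 : forall x, x <= 0 -> u x = 0.
Hypothesis uE : forall x, 0 < x -> u x = c * g x.
Hypothesis g0 : forall x, 0 < x -> 0 < g x.
Hypothesis g_ge0 : forall x, 0 <= x -> 0 <= g x.
Hypothesis cg : forall x, 0 <= x -> {for x, continuous g}.
Hypothesis dG : forall x, 0 <= x -> is_derive x 1 G (g x).
Hypothesis G0 : G 0 = 0.
Hypothesis G1 : G x @[x --> +oo%R] --> (1 : R).

Let G_incr : {in `[0, +oo[ &, {homo G : x y / x < y}}.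
Proof.
move=> x y; rewrite !in_itv/= !andbT => x0 y0 xy.
have cG z : 0 <= z -> {for z, continuous G}.
  by move=> z0; exact: is_derive_continuous (dG z0).
apply: (@gtr0_derive1_lt_cc _ G 0 y) => //.
- by move=> z; rewrite in_itv/= => /andP[/ltW z0 _]; case: (dG z0).
- move=> z; rewrite in_itv/= => /andP[z0 _].
  by rewrite derive1E; case: (dG (ltW z0)) => _ ->; exact: g0.
- by apply: continuous_in_subspaceT => z; rewrite inE/= in_itv/= => /andP[/cG].
- by rewrite in_itv/= x0 ltW.
- by rewrite in_itv/= lexx y0.
Qed.

Let int_u x : 0 <= x ->
  (\int[leb]_(t in `]-oo, x]) (u t)%:E = (c * G x)%:E)%E.
Proof.
move=> x0.
have cgc t : 0 <= t -> {for t, continuous (fun t => c * g t)}.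
  by move=> t0; apply: cvgM; [exact: cvg_cst|exact: cg].
transitivity (\int[leb]_(t in `]0%R, x]) (c * g t)%:E)%E.
  rewrite !integral_itv_if; apply: eq_integral => t _; rewrite !in_itv/=.
  by case: (ltP 0 t) => t0 /=; [rewrite uE|rewrite u0// if_same].
rewrite integral_itv_obnd_cbnd; last first.
  apply/measurable_EFinP; apply: subspace_continuous_measurable_fun => //.
  by apply: continuous_in_subspaceT => z; rewrite inE/= in_itv/= => /andP[/ltW/cgc].
transitivity (c * G x - c * G 0)%:E; last by rewrite G0 mulr0 subr0.
apply: (@integral_is_derive (fun t => c * G t)) => // t /andP[t0 _].
- exact: (is_deriveZ c (dG t0)).
- exact: cgc.
Qed.

Let int_uT : (\int[leb]_t (u t)%:E = c%:E)%E.
Proof.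
have cgc t : 0 <= t -> {for t, continuous (fun t => c * g t)}.
  by move=> t0; apply: cvgM; [exact: cvg_cst|exact: cg].
transitivity (\int[leb]_(t in `]0%R, +oo[) (c * g t)%:E)%E.
  rewrite integral_itv_if; apply: eq_integral => t _; rewrite !in_itv/= andbT.
  by case: (ltP 0 t) => t0 /=; [rewrite uE|rewrite u0].
rewrite integral_itv_obnd_cbnd; last first.
  apply/measurable_EFinP; apply: subspace_continuous_measurable_fun => //.
  by apply: continuous_in_subspaceT => z; rewrite inE/= in_itv/= => /andP[/ltW/cgc].
rewrite (@ge0_continuous_FTC2y _ _ (fun t => c * G t) 0 c).
- by rewrite G0 mulr0 sube0.
- move=> t t0; exact: mulr_ge0 (ltW c0) (g_ge0 t0).
- by apply: continuous_in_subspaceT => z; rewrite inE/= in_itv/= => /andP[/cgc].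
- by rewrite -[X in _ --> X](mulr1 c); apply: cvgM => //; exact: cvg_cst.
- move=> t /ltW t0; by case: (is_deriveZ c (dG t0)).
- apply: cvg_at_right_filter; apply: cvgM; first exact: cvg_cst.
  exact: is_derive_continuous (dG (lexx 0)).
- move=> t; rewrite in_itv/= andbT => /ltW t0.
  by rewrite derive1E; case: (is_deriveZ c (dG t0)).
Qed.

(** The intermediate value theorem gives [x] with [G x = p]; since [G] is strictly increasing, [x]
    is the least point of the set whose infimum is the quantile. *)
Lemma quantileP (p : R) : 0 < p < 1 -> 0 < quantile u p /\ G (quantile u p) = p.
Proof.
move=> /andP[p0 p1].
have cdfE x : 0 <= x -> cdf_of u x = G x.
  by move=> x0; rewrite /cdf_of int_u// int_uT/= mulrC mulKf ?gt_eqF.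
have cdf0 x : x <= 0 -> cdf_of u x = 0.
  move=> x0; rewrite /cdf_of integral0_eq ?mul0r//= => t.
  by rewrite /= in_itv/= => tx; rewrite u0// (le_trans tx).
have [X X0 GX] : exists2 X, 0 <= X & p <= G X.
  have : \forall X \near +oo, p < G X by exact: (cvgr_gt _ G1).
  move=> [M [_ HM]]; exists (Num.max 0 M + 1).
    by rewrite addr_ge0// le_max lexx.
  by apply/ltW/HM; rewrite ltr_pwDr// le_max lexx orbT.
have [x xX Gx] : exists2 x, x \in `[0, X] & G x = p.
  apply: IVT => //.
    apply: continuous_in_subspaceT => z; rewrite inE/= in_itv/= => /andP[z0 _].
    exact: is_derive_continuous (dG z0).
  by rewrite G0 ge_min le_max GX (ltW p0) orbT.
have {xX} x0 : 0 <= x by move: xX; rewrite in_itv/= => /andP[].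
have xp : 0 < x.
  by rewrite lt_neqAle x0 andbT; apply: contra_ltN p0 => /eqP; rewrite -Gx => <-; rewrite G0.
suff -> : quantile u p = x by [].
have Sx : [set x | p <= cdf_of u x] x by rewrite /= cdfE// Gx.
have lbx : lbound [set x | p <= cdf_of u x] x.
  move=> y /=; case: (leP y 0) => y0; first by rewrite cdf0// leNgt p0.
  rewrite (cdfE _ (ltW y0)) -Gx leNgt [_ <= y]leNgt; apply: contra => yx.
  by apply: G_incr => //; rewrite in_itv/= andbT// ltW.
apply/eqP; rewrite eq_le; apply/andP; split.
  by apply: ge_inf => //; exists x.
by apply: lb_le_inf => //; exists x.
Qed.

End Quantile.
End Calculus.

(** * Gamma, chi-square and F distributions *)

Section GammaDensity.
Variable R : realType.
Local Notation leb := (@lebesgue_measure R).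
Implicit Types (x r s u w : R) (k : nat).

(** Density of Gamma(k+1) for [x >= 0], left untruncated so that it is differentiable at 0;
    [gamma_dens] truncates it. *)
Definition gamma_kernel k x : R := x ^+ k / k`!%:R * expR (- x).

(* The cdf of Gamma(k+1), through the closed form 1 - sum_(i <= k) x^i/i! e^-x;
   for even degrees of freedom the chi-square cdf is [gamma_cdf] at x/2. *)
Fixpoint gamma_cdf k x : R :=
  if k is k'.+1 then gamma_cdf k' x - gamma_kernel k x
  else 1 - gamma_kernel 0 x.

Lemma is_derive_gamma_kernel0 x :
  is_derive x 1 (gamma_kernel 0) (- gamma_kernel 0 x).
Proof.
have -> : gamma_kernel 0 = expR \o -%R.
  by apply/funext => y; rewrite /gamma_kernel expr0 fact0 divr1 mul1r.
by apply: is_derive_eq; rewrite /= mulrN1.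
Qed.

Lemma is_derive_gamma_kernel k x : is_derive x 1 (gamma_kernel k.+1)
  (gamma_kernel k x - gamma_kernel k.+1 x).
Proof.
have H : gamma_kernel k.+1 = (k.+1`!%:R^-1 \*: ((@id R) ^+ k.+1)) * (expR \o -%R).
  apply/funext => y; rewrite /gamma_kernel !fctE /= /GRing.scale/=.
  by rewrite (mulrC (y ^+ _)).
rewrite [X in is_derive _ _ X _]H.
apply: is_derive_eq.
rewrite !fctE /gamma_kernel /GRing.scale/= factS natrM.
have f0 : k`!%:R != 0 :> R by rewrite pnatr_eq0 -lt0n fact_gt0.
have k0 : k.+1%:R != 0 :> R by rewrite pnatr_eq0.
rewrite -[_ *: x ^+ k.+1]/(_ * x ^+ k.+1) exprS.
by field; rewrite f0 nat1r k0.
Qed.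

(** The derivatives of the successive kernels telescope. *)
Lemma is_derive_gamma_cdf k x : is_derive x 1 (gamma_cdf k) (gamma_kernel k x).
Proof.
elim: k => [|k IH].
  have -> : gamma_cdf 0 = cst 1 - gamma_kernel 0 by [].
  have H := is_derive_gamma_kernel0 x.
  by apply: is_derive_eq; rewrite sub0r opprK.
have -> : gamma_cdf k.+1 = gamma_cdf k - gamma_kernel k.+1 by [].
have H := is_derive_gamma_kernel k x.
by apply: is_derive_eq; rewrite opprB addrC subrK.
Qed.

Lemma gamma_kernel_ge0 k x : 0 <= x -> 0 <= gamma_kernel k x.
Proof. by move=> x0; rewrite !mulr_ge0 ?expR_ge0 ?exprn_ge0 ?invr_ge0. Qed.

Lemma gamma_kernel_gt0 k x : 0 < x -> 0 < gamma_kernel k x.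
Proof.
by move=> x0; rewrite !mulr_gt0 ?expR_gt0 ?exprn_gt0 ?invr_gt0 ?ltr0n ?fact_gt0.
Qed.

Lemma continuous_gamma_kernel k : continuous (gamma_kernel k).
Proof.
move=> x; case: k => [|k].
  exact: is_derive_continuous (is_derive_gamma_kernel0 x).
exact: is_derive_continuous (is_derive_gamma_kernel k x).
Qed.

Lemma gamma_cdf0 k : gamma_cdf k 0 = 0.
Proof.
elim: k => [|k IH] /=; rewrite /gamma_kernel ?IH oppr0 expR0.
  by rewrite expr0 fact0 divr1 mulr1 subrr.
by rewrite expr0n mul0r mul0r subr0.
Qed.

(** The exponential series gives [x ^+ k.+1 / k.+1! <= expR x], so the kernel is at most
    [(k + 1) / x]. *)
Lemma gamma_kernel_cvgy k : gamma_kernel k x @[x --> +oo%R] --> (0 : R).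
Proof.
apply: (@squeeze_cvgr _ _ _ _ (cst 0) (fun x => k.+1%:R * x^-1)).
- near=> x.
  have x0 : 0 < x by near: x; exact: nbhs_pinfty_gt.
  rewrite /= (gamma_kernel_ge0 k (ltW x0)) /gamma_kernel expRN ler_pdivrMr ?expR_gt0//.
  apply: (@le_trans _ _ (k.+1%:R * x^-1 * (x ^+ k.+1 / k.+1`!%:R))).
    rewrite le_eqVlt; apply/predU1P; left.
    have f0 : k`!%:R != 0 :> R by rewrite pnatr_eq0 -lt0n fact_gt0.
    have k0 : k.+1%:R != 0 :> R by rewrite pnatr_eq0.
    by rewrite factS natrM exprS; field; rewrite f0 nat1r k0 gt_eqF.
  rewrite ler_wpM2l ?mulr_ge0 ?invr_ge0 ?(ltW x0)//.
  by apply: le_trans (expR_ge1Dxn k (ltW x0)); rewrite lerDr.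
- exact: cvg_cst.
- rewrite -[X in _ --> X](mulr0 k.+1%:R); apply: cvgM; first exact: cvg_cst.
  apply/gtr0_cvgV0; last exact: cvg_id.
  exact: nbhs_pinfty_gt.
Unshelve. all: end_near. Qed.

Lemma gamma_cdf_cvgy k : gamma_cdf k x @[x --> +oo%R] --> (1 : R).
Proof.
elim: k => [|k IH]; rewrite -(subr0 1); apply: cvgB.
- exact: cvg_cst.
- exact: gamma_kernel_cvgy.
- exact: IH.
- exact: gamma_kernel_cvgy.
Qed.

Lemma integral_gamma_kernel k a b : a <= b ->
  (\int[leb]_(x in `[a, b]) (gamma_kernel k x)%:E =
   (gamma_cdf k b - gamma_cdf k a)%:E)%E.
Proof.
move=> ab; apply: integral_is_derive => // x _.
  exact: is_derive_gamma_cdf.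
exact: continuous_gamma_kernel.
Qed.

(** Half of a chi-square variable with 2d degrees of freedom is Gamma(d); the total mass of the
    unnormalised density is [2 ^+ d * (d - 1)!]. *)
Lemma chi2qP (d : nat) (p : R) : (0 < d)%N -> 0 < p < 1 ->
  0 < chi2q (2 * d) p /\ gamma_cdf d.-1 (chi2q (2 * d) p / 2) = p.
Proof.
move=> d0 p01; rewrite /chi2q.
have dh x : is_derive x 1 (fun x : R => x / 2) (2^-1).
  have -> : (fun x : R => x / 2) = 2^-1 \*: (@id R).
    by apply/funext => y; rewrite mulrC.
  by apply: is_derive_eq; rewrite /GRing.scale/= mulr1.
apply: (@quantileP _ _ (fun x => gamma_kernel d.-1 (x / 2) * 2^-1)
  (fun x => gamma_cdf d.-1 (x / 2)) (2 ^+ d * d.-1`!%:R)) => //.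
- by move=> x x0; rewrite /chi2_udens ltNge x0.
- move=> x x0; rewrite /chi2_udens x0 /gamma_kernel.
  have -> : (2 * d)%:R / 2 - 1 = d.-1%:R :> R.
    by case: d d0 {p01} => // d _; rewrite natrM -natr1/=; field.
  rewrite (powR_mulrn _ (ltW x0)) expr_div_n -mulNr.
  have f0 : d.-1`!%:R != 0 :> R by rewrite pnatr_eq0 -lt0n fact_gt0.
  have t0 : 2 ^+ d.-1 != 0 :> R by rewrite expf_neq0// pnatr_eq0.
  by rewrite -[in 2 ^+ d](prednK d0) exprS; field; rewrite f0 t0.
- by move=> x x0; rewrite mulr_gt0 ?gamma_kernel_gt0 ?divr_gt0 ?invr_gt0.
- by move=> x x0; rewrite mulr_ge0 ?gamma_kernel_ge0 ?divr_ge0 ?invr_ge0.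
- move=> x _; apply: cvgM; last exact: cvg_cst.
  apply: (@continuous_comp _ _ _ (fun x => x / 2) (gamma_kernel d.-1)).
    exact: is_derive_continuous (dh x).
  exact: continuous_gamma_kernel.
- move=> x _; apply: is_derive1_comp; exact: is_derive_gamma_cdf.
- by rewrite mul0r gamma_cdf0.
- apply: (cvg_comp (fun x : R => x / 2) (gamma_cdf d.-1)); last exact: gamma_cdf_cvgy.
  by apply: gt0_cvgMly; rewrite ?invr_gt0.
Qed.

End GammaDensity.

Section FisherQuantile.
Variable R : realType.

(** With 2 numerator degrees of freedom the power of [t] has exponent 0. The density is then
    [(1 + t / d)] to the power [- d - 1], of total mass 1, with an elementary cdf. *)
Lemma FqP (d : nat) (p : R) : (0 < d)%N -> 0 < p < 1 ->
  0 < Fq 2 (2 * d) p /\ (1 + Fq 2 (2 * d) p / d%:R)^-1 ^+ d = 1 - p.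
Proof.
move=> d0 p01; rewrite /Fq.
have dp : 0 < d%:R :> R by rewrite ltr0n.
have dn0 : d%:R != 0 :> R by rewrite gt_eqF.
pose y (x : R) := 1 + x / d%:R.
have y0 (x : R) : 0 <= x -> 0 < y x by move=> x0; rewrite ltr_pwDl// divr_ge0// ltW.
have dy (x : R) : is_derive x 1 y (d%:R^-1).
  have -> : y = cst 1 + d%:R^-1 \*: (@id R).
    by apply/funext => z; rewrite /y mulrC.
  by apply: is_derive_eq; rewrite /GRing.scale/= mulr1 add0r.
have powE (x : R) : 0 <= x -> powR (y x) (- d%:R) = (y x)^-1 ^+ d.
  by move=> x0; rewrite powRN (powR_mulrn _ (ltW (y0 _ x0))) exprVn.
suff [q0 H] : 0 < quantile (Fdist_udens 2 (2 * d)) p /\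
    1 - powR (y (quantile (Fdist_udens 2 (2 * d)) p)) (- d%:R) = p.
  split=> //; move: H; rewrite (powE _ (ltW q0)) => H.
  by rewrite -[in RHS]H subKr.
apply: (@quantileP _ _ (fun x => powR (y x) (- d%:R - 1))
  (fun x => 1 - powR (y x) (- d%:R)) 1) => //.
- by move=> x x0; rewrite /Fdist_udens ltNge x0.
- move=> x x0; rewrite /Fdist_udens x0 mul1r natrM.
  rewrite mulfV ?pnatr_eq0// subrr powRr0 mul1r.
  congr (powR _ _); first by rewrite /y; field.
  by field.
- by move=> x x0; rewrite powR_gt0// y0// ltW.
- by move=> x x0; rewrite powR_ge0.
- move=> x x0.
  have H := is_derive1_powR (- d%:R - 1) (y0 _ x0).
  exact: is_derive_continuous (is_derive1_comp H (dy x)).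
- move=> x x0.
  have H := is_derive1_comp (is_derive1_powR (- d%:R) (y0 _ x0)) (dy x).
  have -> : (fun x => 1 - powR (y x) (- d%:R)) = cst 1 - ((fun z : R => powR z (- d%:R)) \o y) by [].
  by apply: is_derive_eq; rewrite sub0r; field.
- by rewrite /y mul0r addr0 powR1 subrr.
- rewrite -[X in _ --> X](subr0 1); apply: cvgB; first exact: cvg_cst.
  apply: (@squeeze_cvgr _ _ _ _ (cst 0) (fun x => (y x)^-1)).
  + near=> x.
    have x0 : 0 <= x by near: x; exact: nbhs_pinfty_ge.
    rewrite /= powR_ge0 (powE _ x0) exprVn lef_pV2 ?posrE ?exprn_gt0 ?y0//.
    by rewrite ler_eXnr// /y lerDl divr_ge0// ltW.
  + exact: cvg_cst.
  + apply/gtr0_cvgV0.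
      by near=> x; apply: y0; near: x; exact: nbhs_pinfty_ge.
    apply: (@ger_cvgy _ _ _ _ (fun x => x / d%:R)).
      by near=> x; rewrite /y lerDr.
    by apply: gt0_cvgMly; rewrite ?invr_gt0.
Unshelve. all: end_near. Qed.

End FisherQuantile.

(** * Sums of independent standard exponential variables *)

Section GammaConvolution.
Variable R : realType.
Local Notation leb := (@lebesgue_measure R).
Implicit Types (x r s u w : R) (k : nat).

Definition gamma_dens k x : R := if 0 <= x then gamma_kernel k x else 0.

Lemma gamma_dens_ge0 k x : 0 <= gamma_dens k x.
Proof. by rewrite /gamma_dens; case: ifP => // /gamma_kernel_ge0. Qed.

Lemma measurable_gamma_dens k : measurable_fun setT (gamma_dens k).
Proof.
apply: measurable_fun_ifT => //.
  by apply: measurable_fun_ler => //; exact: measurable_cst.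
by apply: continuous_measurable_fun; exact: continuous_gamma_kernel.
Qed.

(** Integral along a line [u + s = r]: there [expR (- u)] times the kernel at [s] is [expR (- r)]
    times a power of [r - u], so [c] will be [expR (- r)]. *)
Lemma integral_subX k c r a b : a <= b ->
  (\int[leb]_(u in `[a, b]) (c * ((r - u) ^+ k / k`!%:R))%:E =
   (c * ((r - a) ^+ k.+1 - (r - b) ^+ k.+1) / k.+1`!%:R)%:E)%E.
Proof.
move=> ab; pose F u := - (c * ((r - u) ^+ k.+1 / k.+1`!%:R)).
transitivity (F b - F a)%:E; last by rewrite /F; congr EFin; ring.
have dF u : is_derive u 1 F (c * ((r - u) ^+ k / k`!%:R)).
  have -> : F = (- (c / k.+1`!%:R)) \*: ((cst r - @id R) ^+ k.+1).
    by apply/funext => z; rewrite /F !fctE /= /GRing.scale/=; ring.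
  apply: is_derive_eq; rewrite /GRing.scale/= !fctE factS natrM.
  have f0 : k`!%:R != 0 :> R by rewrite pnatr_eq0 -lt0n fact_gt0.
  have k0 : k.+1%:R != 0 :> R by rewrite pnatr_eq0.
  by field; rewrite f0 nat1r k0.
apply: integral_is_derive => // u _.
apply: cvgM; first exact: cvg_cst.
apply: cvgM; last exact: cvg_cst.
apply: (@continuous_comp _ _ _ (fun u => r - u) (fun z => z ^+ k)).
  by apply: cvgB; [exact: cvg_cst|exact: cvg_id].
exact: exprn_continuous.
Qed.

Lemma gamma_dens_conv k r :
  (\int[leb]_u (gamma_dens 0 u * gamma_dens k (r - u))%:E = (gamma_dens k.+1 r)%:E)%E.
Proof.
pose f u := expR (- r) * ((r - u) ^+ k / k`!%:R).
transitivity (\int[leb]_u if (u \in `[0%R, r]) then (f u)%:E else 0)%E.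
  apply: eq_integral => u _; rewrite in_itv/= /gamma_dens subr_ge0.
  case: (leP 0 u) => u0 /=; last by rewrite mul0r.
  case: (leP u r) => ur /=; last by rewrite mulr0.
  rewrite /gamma_kernel /f expr0 fact0 divr1 mul1r; congr EFin.
  rewrite mulrCA -expRD mulrC; congr (expR _ * _); ring.
rewrite -integral_itv_if /gamma_dens; case: leP => r0; last first.
  by rewrite set_itv_ge ?integral_set0// bnd_simp -ltNge.
rewrite integral_subX// subrr subr0 expr0n /= subr0 /gamma_kernel.
by rewrite -mulrA mulrC.
Qed.

(* [exp_iter k psi w] is the expectation of psi (w + T_1 + ... + T_k) for
   independent standard exponentials T_i. *)
Fixpoint exp_iter k (psi : R -> R) w : \bar R :=
  if k is k'.+1 then
    (\int[leb]_u ((gamma_dens 0 u)%:E * exp_iter k' psi (w + u)))%E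
  else (psi w)%:E.

Lemma exp_iterS k (psi : R -> R) w : exp_iter k.+1 psi w =
  (\int[leb]_u ((gamma_dens 0 u)%:E * exp_iter k psi (w + u)))%E.
Proof. by []. Qed.

(** A sum of k+1 standard exponentials is Gamma(k+1). In the induction step, substitute the new
    total [r = u + s], exchange the integrals by Tonelli and convolve the densities. *)
Lemma exp_iterE k (psi : R -> R) w : measurable_fun setT psi ->
  (forall s, 0 <= psi s) ->
  (exp_iter k.+1 psi w = \int[leb]_s (gamma_dens k s * psi (w + s))%:E)%E.
Proof.
move=> mpsi psi0; elim: k w => [//|k IH] w.
have shift v a : measurable_fun setT (fun s : R => v + a * s).
  by apply: measurable_funD => //; exact: mulrl_measurable.
transitivity (\int[leb]_u \int[leb]_r
    (gamma_dens 0 u * gamma_dens k (r - u) * psi (w + r))%:E)%E.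
  rewrite exp_iterS; apply: eq_integral => u _.
  rewrite IH -ge0_integralZl_EFin//; last 3 first.
  - by move=> s _; rewrite lee_fin mulr_ge0// gamma_dens_ge0.
  - apply/measurable_EFinP; apply: measurable_funM.
      exact: measurable_gamma_dens.
    apply: (measurableT_comp mpsi).
    by have := shift (w + u) 1; under eq_fun do rewrite mul1r.
  - exact: gamma_dens_ge0.
  rewrite [RHS](@integral_affine _ _ 1 u)//.
  - rewrite mul1e; apply: eq_integral => s _.
    by rewrite mul1r addrK addrA (addrAC w) -!EFinM mulrA.
  - apply/measurable_EFinP; apply: measurable_funM; last first.
      apply: (measurableT_comp mpsi).
      by have := shift w 1; under eq_fun do rewrite mul1r.
    apply: measurable_funM => //; apply: (measurableT_comp (measurable_gamma_dens k)).
    by have := shift (- u) 1; under eq_fun do rewrite mul1r addrC.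
  - by move=> s; rewrite lee_fin !mulr_ge0// gamma_dens_ge0.
pose f (z : R * R) := (gamma_dens 0 z.1 * gamma_dens k (z.2 - z.1) * psi (w + z.2))%:E.
have mf : measurable_fun setT f.
  apply/measurable_EFinP; apply: measurable_funM.
    apply: measurable_funM.
      exact: (measurableT_comp (measurable_gamma_dens 0)).
    by apply: (measurableT_comp (measurable_gamma_dens k)); exact: measurable_funB.
  by apply: (measurableT_comp mpsi); exact: measurable_funD.
transitivity (\int[leb]_r \int[leb]_u f (u, r))%E.
  apply: (@fubini_tonelli _ _ _ _ _ leb leb f mf) => z.
  by rewrite /f lee_fin !mulr_ge0// gamma_dens_ge0.
apply: eq_integral => r _; rewrite /f/=.
under eq_integral do rewrite mulrC EFinM.
rewrite ge0_integralZl_EFin//.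
- by rewrite gamma_dens_conv -EFinM mulrC.
- by move=> u _; rewrite lee_fin mulr_ge0// gamma_dens_ge0.
- apply/measurable_EFinP; apply: measurable_funM; first exact: measurable_gamma_dens.
  apply: (measurableT_comp (measurable_gamma_dens k)).
  by have := shift r (-1); under eq_fun do rewrite mulN1r.
Qed.

Lemma exp_iter_ge0 k (psi : R -> R) w : (forall s, 0 <= psi s) ->
  (0 <= exp_iter k psi w)%E.
Proof.
move=> psi0; elim: k w => [|k IH] w /=; first by rewrite lee_fin.
by apply: integral_ge0 => u _; rewrite mule_ge0// lee_fin gamma_dens_ge0.
Qed.

Lemma measurable_exp_iter k (psi : R -> R) : measurable_fun setT psi ->
  (forall s, 0 <= psi s) -> measurable_fun setT (exp_iter k psi).
Proof.
move=> mpsi psi0; case: k => [|k]; first exact/measurable_EFinP.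
pose f (z : R * R) := (gamma_dens k z.2 * psi (z.1 + z.2))%:E.
rewrite (_ : exp_iter k.+1 psi = fubini_F leb f); last first.
  by apply/funext => w; rewrite exp_iterE.
apply: measurable_fun_fubini_tonelli_F.
- apply/measurable_EFinP; apply: measurable_funM.
    exact: (measurableT_comp (measurable_gamma_dens k)).
  by apply: (measurableT_comp mpsi); exact: measurable_funD.
- by move=> z; rewrite lee_fin mulr_ge0// gamma_dens_ge0.
Qed.

Lemma exp_iterZ k (psi : R -> R) c w : 0 <= c -> measurable_fun setT psi ->
  (forall s, 0 <= psi s) ->
  exp_iter k (fun s => c * psi s) w = (c%:E * exp_iter k psi w)%E.
Proof.
move=> c0 mpsi psi0; elim: k w => [|k IH] w /=; first by rewrite EFinM.
rewrite -ge0_integralZl_EFin//.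
- by apply: eq_integral => u _; rewrite IH muleCA.
- by move=> u _; apply: mule_ge0; [rewrite lee_fin; exact: gamma_dens_ge0|exact: exp_iter_ge0].
- apply: emeasurable_funM; first by apply/measurable_EFinP; exact: measurable_gamma_dens.
  apply: (measurableT_comp (measurable_exp_iter k mpsi psi0)).
  exact: measurable_funD.
Qed.

End GammaConvolution.

(** * The law of the normalized spacings *)

Section Spacings.
Variables (R : realType) (m : nat) (Rs : nat -> nat) (th : R * R).
Hypothesis Tth : Theta th.
Local Notation leb := (@lebesgue_measure R).
Local Notation mu := th.1.
Local Notation sigma := th.2.
Local Notation gamma := (@gam R m Rs).
Implicit Types (t x w : R) (s : seq R) (psi : R -> R).

Let sigma0 : 0 < sigma. Proof. exact: Tth. Qed.

Lemma gam_recl j : (j < m)%N -> gamma j = (Rs j).+1%:R + gamma j.+1.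
Proof. by move=> jm; rewrite /gam big_ltn// natrD. Qed.

Lemma gam_gt0 j : (j < m)%N -> 0 < gamma j.
Proof. by move=> jm; rewrite gam_recl// ltr_pwDl ?ltr0n// ler0n. Qed.

Definition pc_factor j t : R := gamma j * expf th t * (1 - expF th t) ^+ Rs j.

(* In both fixpoints [s] lists the order statistics of index j, j+1, ... and
   [x] is the order statistic preceding them. *)
Fixpoint spacing_sum j x s : R :=
  if s is t :: s' then gamma j * (t - x) / sigma + spacing_sum j.+1 t s' else 0.

Fixpoint pc_tail_density j x s : R :=
  if s is t :: s' then
    if x <= t then pc_factor j t * pc_tail_density j.+1 t s' else 0
  else 1.

Lemma eq_iint k (f g : k.-tuple R -> \bar R) : f =1 g -> iint f = iint g.
Proof. by move=> /funext ->. Qed.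

Lemma iintS k (f : k.+1.-tuple R -> \bar R) :
  (iint f = \int[leb]_t iint (fun xs => f (cons_tuple t xs)))%E.
Proof. by []. Qed.

Lemma iint0 k : iint (fun _ : k.-tuple R => 0%E : \bar R) = 0%E.
Proof. by elim: k => [//|k IH] /=; under eq_integral do rewrite IH; exact: integral0. Qed.

(** The recursion [gamma j = Rs j + 1 + gamma j.+1], read in the exponent: the density factor at [t]
    times the survival factor of the later variables is an exponential density of rate
    [gamma j / sigma]. *)
Lemma pc_factor_expR j t : (j < m)%N -> mu < t ->
  pc_factor j t * expR (- (gamma j.+1 * (t - mu) / sigma)) =
  gamma j / sigma * expR (- (gamma j * (t - mu) / sigma)).
Proof.
move=> jm mut; rewrite /pc_factor /expf /expF mut subKr -expRM_natl.
set E := expR (- (gamma j * _ / _)).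
suff -> : E = expR (- (t - mu) / sigma) * expR ((Rs j)%:R * (- (t - mu) / sigma)) *
    expR (- (gamma j.+1 * (t - mu) / sigma)) by ring.
rewrite -!expRD /E (gam_recl jm) -natr1; congr expR.
by field; rewrite gt_eqF.
Qed.

Lemma pc_factor_ge0 j t : (j < m)%N -> 0 <= pc_factor j t.
Proof.
move=> jm; have /andP[_ F1] := expF_itv t Tth.
have e0 : 0 <= expf th t.
  rewrite /expf; case: ifP => // _; exact: divr_ge0 (expR_ge0 _) (ltW sigma0).
have g0 := ltW (gam_gt0 jm).
by rewrite /pc_factor !mulr_ge0// exprn_ge0// subr_ge0 ltW.
Qed.

(* Integrating out X_j, ..., X_(m-1) above X_(j-1) = x: substituting the
   normalized spacing for each variable leaves the survival factor of x. *)
Lemma iint_tail k j x w psi : (j + k)%N = m -> mu < x ->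
  measurable_fun setT psi -> (forall y, 0 <= psi y) ->
  iint (fun xs : k.-tuple R =>
    (psi (w + spacing_sum j x xs) * pc_tail_density j x xs)%:E) =
  ((expR (- (gamma j * (x - mu) / sigma)))%:E * exp_iter k psi w)%E.
Proof.
elim: k j x w psi => [|k IH] j x w psi jkm mux mpsi psi0.
  rewrite /= addr0 mulr1 /gam big_geq ?mul0r ?oppr0 ?expR0 ?mul1e//.
  by rewrite -jkm addn0.
have jm : (j < m)%N by rewrite -jkm addnS ltnS leq_addr.
have gj0 := gam_gt0 jm.
pose a := gamma j / sigma.
have a0 : 0 < a by rewrite divr_gt0.
pose h u := ((gamma_dens 0 u)%:E * exp_iter k psi (w + u))%E.
have h0 u : (0 <= h u)%E.
  by apply: mule_ge0; [rewrite lee_fin; exact: gamma_dens_ge0|exact: exp_iter_ge0].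
have mh : measurable_fun setT h.
  apply: emeasurable_funM; first by apply/measurable_EFinP; exact: measurable_gamma_dens.
  apply: (measurableT_comp (measurable_exp_iter k mpsi psi0)).
  exact: measurable_funD.
have mha : measurable_fun setT (fun t => h (a * t + - (a * x))).
  by apply: (measurableT_comp mh); exact: measurable_affine.
rewrite iintS exp_iterS -/h (integral_affine (- (a * x)) a0 mh h0).
rewrite muleA -EFinM -ge0_integralZl_EFin//; last first.
  exact: mulr_ge0 (expR_ge0 _) (ltW a0).
apply: eq_integral => t _.
have [xt|tx] := leP x t; last first.
  rewrite (@eq_iint _ _ (fun=> 0%E)) ?iint0; last first.
    by move=> xs; rewrite /= leNgt tx/= mulr0.
  rewrite /h /gamma_dens -mulrBr pmulr_rge0// subr_ge0 leNgt tx/=.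
  by rewrite mul0e mule0.
have mut : mu < t by exact: lt_le_trans xt.
rewrite (@eq_iint _ _ (fun xs : k.-tuple R =>
    (pc_factor j t * psi (w + gamma j * (t - x) / sigma + spacing_sum j.+1 t xs)
     * pc_tail_density j.+1 t xs)%:E)); last first.
  by move=> xs; rewrite /= xt addrA mulrA (mulrC (psi _)).
(* For fixed [t] the factor of the current variable is a constant and is absorbed into the test
   function. *)
rewrite (IH j.+1 t _ (fun y => pc_factor j t * psi y))//; last 3 first.
- by rewrite addSn -addnS.
- exact: measurable_funM.
- by move=> s; rewrite mulr_ge0// pc_factor_ge0.
rewrite exp_iterZ ?pc_factor_ge0// muleA -EFinM mulrC pc_factor_expR//.
rewrite /h -mulrBr /gamma_dens mulr_ge0 ?subr_ge0 ?(ltW a0)//.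
have -> : gamma j * (t - x) / sigma = a * (t - x) by rewrite /a mulrAC.
rewrite muleA -EFinM; congr ((_)%:E * _)%E.
rewrite /gamma_kernel expr0 fact0 divr1 mul1r.
rewrite [RHS]mulrAC -[in RHS]expRD [RHS]mulrC; congr (_ * expR _).
by rewrite /a; field; rewrite gt_eqF.
Qed.

(** The first spacing is measured from [mu] and stays a separate argument of [phi]; the other k+1
    collapse into one Gamma(k+1) variable. The strict [0 < u] matches the strict [mu < t] in [expf],
    so the integrands agree at every point. *)
Lemma iint_pc_prob (phi : R * R -> R) k : m = k.+2 -> measurable_fun setT phi ->
  (forall z, 0 <= phi z) ->
  iint (fun xs : k.+2.-tuple R =>
    (phi (gamma 0 * (thead xs - mu) / sigma, spacing_sum 1 (thead xs) (behead xs)) *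
     (pc_factor 0 (thead xs) * pc_tail_density 1 (thead xs) (behead xs)))%:E) =
  (\int[leb]_u \int[leb]_s
     ((if 0 < u then expR (- u) else 0) * gamma_dens k s * phi (u, s))%:E)%E.
Proof.
move=> mk mphi phi0.
have m0 : (0 < m)%N by rewrite mk.
have g0 := gam_gt0 m0.
pose a := gamma 0 / sigma.
have a0 : 0 < a by rewrite divr_gt0.
pose f (z : R * R) :=
  ((if 0 < z.1 then expR (- z.1) else 0) * gamma_dens k z.2 * phi z)%:E.
have e0 (u : R) : 0 <= if 0 < u then expR (- u) else 0 by case: ifP => // _; exact: expR_ge0.
have f0 z : (0 <= f z)%E by rewrite lee_fin !mulr_ge0// gamma_dens_ge0.
have mf : measurable_fun setT f.
  apply/measurable_EFinP; apply: measurable_funM => //.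
  apply: measurable_funM; last exact: (measurableT_comp (measurable_gamma_dens k)).
  apply: measurable_fun_ifT => //; first exact: measurable_fun_ltr.
  by apply: (measurableT_comp (@measurable_expR R)); exact: measurable_funN.
have mphi1 u : measurable_fun setT (fun y => phi (u, y)).
  exact: (measurableT_comp mphi (measurable_pair1 u)).
pose F := fubini_F leb f.
have mF : measurable_fun setT F by exact: measurable_fun_fubini_tonelli_F.
have F0 u : (0 <= F u)%E by apply: integral_ge0 => s _; exact: f0.
rewrite iintS [RHS](@integral_affine _ F a (- (a * mu)) a0 mF F0).
have mFa : measurable_fun setT (fun t => F (a * t + - (a * mu))).
  by apply: (measurableT_comp mF); exact: measurable_affine.
rewrite -ge0_integralZl_EFin ?(ltW a0)//.
apply: eq_integral => t _; rewrite -mulrBr.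
pose psi (y : R) := pc_factor 0 t * phi (a * (t - mu), y).
rewrite (@eq_iint _ _ (fun xs : k.+1.-tuple R =>
    (psi (0 + spacing_sum 1 t xs) * pc_tail_density 1 t xs)%:E)); last first.
  move=> xs; rewrite /thead /tnth /= add0r /psi /a mulrA (mulrC (phi _)).
  by rewrite (mulrAC (gamma 0)).
have [mut|tmu] := leP t mu.
  rewrite (@eq_iint _ _ (fun=> 0%E)) ?iint0; last first.
    move=> xs; rewrite /psi /pc_factor /expf ltNge mut/=.
    by rewrite mulr0 !mul0r.
  rewrite /F /fubini_F integral0_eq ?mule0// => s _.
  by rewrite /f/= pmulr_rgt0// subr_gt0 ltNge mut/= !mul0r.
rewrite iint_tail//; last 2 first.
- by apply: measurable_funM => //; exact: mphi1.
- by move=> s; rewrite mulr_ge0// pc_factor_ge0.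
rewrite /psi exp_iterZ ?pc_factor_ge0// muleA -EFinM mulrC pc_factor_expR//.
rewrite EFinM -muleA; congr (_ * _)%E.
rewrite exp_iterE// -ge0_integralZl_EFin ?expR_ge0//; last 2 first.
- by move=> s _; rewrite lee_fin mulr_ge0// gamma_dens_ge0.
- apply/measurable_EFinP; apply: measurable_funM; first exact: measurable_gamma_dens.
  by under eq_fun do rewrite add0r; exact: mphi1.
apply: eq_integral => s _; rewrite /f /= pmulr_rgt0// subr_gt0 tmu.
by rewrite add0r -EFinM mulrA (mulrAC (gamma 0)).
Qed.

Lemma spacing_sumE j x s : spacing_sum j x s =
  sigma^-1 * \sum_(j <= i < j + size s)
    gamma i * (nth 0 (x :: s) (i - j).+1 - nth 0 (x :: s) (i - j)).
Proof.
elim: s j x => [|t s IH] j x /=; first by rewrite addn0 big_geq ?mulr0.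
rewrite IH addnS [in RHS]big_ltn ?ltnS ?leq_addr// subnn/= [RHS]mulrDr.
congr (_ + _); first by rewrite mulrC.
rewrite addSn; congr (_ * _).
rewrite !big_nat; apply: eq_bigr => i /andP[ji _].
by rewrite -(subnSK ji).
Qed.

Lemma pc_tail_densityE j x s : pc_tail_density j x s =
  if path <=%R x s then \prod_(j <= i < j + size s) pc_factor i (nth 0 s (i - j))
  else 0.
Proof.
elim: s j x => [|t s IH] j x /=; first by rewrite addn0 big_geq.
case: (x <= t) => //=; rewrite IH; case: ifP => _; last by rewrite mulr0.
rewrite addnS [in RHS]big_ltn ?ltnS ?leq_addr// subnn/=; congr (_ * _).
rewrite addSn !big_nat; apply: eq_bigr => i /andP[ji _].
by rewrite -(subnSK ji).
Qed.

End Spacings.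

(** The pair of normalised estimators is pivotal: the right-hand side involves [th] only through
    [phi], and its density is a product, which is the independence of the two pivots. *)
Lemma pc_prob_law (R : realType) (k : nat) (Rs : nat -> nat) (th : R * R)
    (E : set (k.+2.-tuple R)) (phi : R * R -> R) :
  Theta th -> measurable_fun setT phi -> (forall z, 0 <= phi z) ->
  (forall x, \1_E x = phi (gam R k.+2 Rs 0 * (hmu x - th.1) / th.2,
                           k.+2%:R * hsig Rs x / th.2)) ->
  pc_prob Rs th E = (\int[@lebesgue_measure R]_u \int[@lebesgue_measure R]_s
     ((if 0 < u then expR (- u) else 0) * gamma_dens k s * phi (u, s))%:E)%E.
Proof.
move=> Tth mphi phi0 phiE; rewrite -(iint_pc_prob Rs Tth erefl mphi phi0).
apply: eq_iint => x; rewrite phiE; congr (_%:E).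
case/tupleP: x => t xs; rewrite theadE /=.
have sz : (1 + size xs)%N = k.+2 by rewrite size_tuple.
congr (phi (_, _) * _).
  rewrite spacing_sumE /hsig mulrA mulfV ?pnatr_eq0// mul1r mulrC sz.
  congr (_ * _); rewrite !big_nat; apply: eq_bigr => i /andP[i0 _].
  by rewrite subnSK// subn1; case: i i0.
rewrite /pc_density /= pc_tail_densityE sz.
case: ifP => _; last by rewrite mulr0.
rewrite big_ord_recl tnth0; congr (_ * _).
rewrite big_add1 big_mkord; apply: eq_bigr => i _.
by rewrite tnthS /pc_factor (tnth_nth 0) /= subn1.
Qed.

(** * Coverage of the bands *)

Section Bands.
Variable R : realType.
Local Notation leb := (@lebesgue_measure R).

Lemma gamma_cdf_homo k (a b : R) : 0 <= a -> a <= b ->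
  gamma_cdf k a <= gamma_cdf k b.
Proof.
move=> a0 ab; rewrite -subr_ge0 -lee_fin -integral_gamma_kernel//.
apply: integral_ge0 => x /=; rewrite in_itv/= => /andP[ax _].
by rewrite lee_fin gamma_kernel_ge0// (le_trans a0).
Qed.

(** Weak monotonicity of the cdf suffices: quantiles in the reverse order would force the levels
    into the reverse order. *)
Lemma chi2q_lt d (p q : R) : (0 < d)%N -> 0 < p -> p < q -> q < 1 ->
  chi2q (2 * d) p < chi2q (2 * d) q.
Proof.
move=> d0 p0 pq q1.
have [|_ Ep] := @chi2qP _ d p d0; first by rewrite p0 (lt_trans pq).
have [|q0 Eq] := @chi2qP _ d q d0; first by rewrite q1 (lt_trans p0).
rewrite ltNge; apply: contraTN pq => le; rewrite -leNgt -Ep -Eq.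
by rewrite gamma_cdf_homo ?divr_ge0 ?(ltW q0)// ler_pM2r ?invr_gt0.
Qed.

Lemma Fq_lt d (p q : R) : (0 < d)%N -> 0 < p -> p < q -> q < 1 ->
  Fq 2 (2 * d) p < Fq 2 (2 * d) q.
Proof.
move=> d0 p0 pq q1.
have [|fp0 Ep] := @FqP _ d p d0; first by rewrite p0 (lt_trans pq).
have [|fq0 Eq] := @FqP _ d q d0; first by rewrite q1 (lt_trans p0).
have dp : 0 < d%:R :> R by rewrite ltr0n.
have y0 (f : R) : 0 < f -> 0 < 1 + f / d%:R by move=> f0; rewrite addr_gt0// divr_gt0.
rewrite ltNge; apply: contraTN pq => le; rewrite -leNgt -lerN2 -(lerD2l 1) -Ep -Eq.
rewrite lerXn2r ?nnegrE ?invr_ge0 ?(ltW (y0 _ _))//.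
by rewrite lef_pV2 ?posrE ?y0// lerD2l ler_pM2r ?invr_gt0.
Qed.

Lemma integral_gamma_kernelZ k c (a b : R) : a <= b ->
  (\int[leb]_s (if s \in `[a, b] then (c * gamma_kernel k s)%:E else 0) =
   (c * (gamma_cdf k b - gamma_cdf k a))%:E)%E.
Proof.
move=> ab; rewrite -integral_itv_if mulrBr.
apply: (@integral_is_derive _ (fun x => c * gamma_cdf k x)) => // x _.
  exact: (is_deriveZ c (is_derive_gamma_cdf k x)).
by apply: cvgM; [exact: cvg_cst|exact: continuous_gamma_kernel].
Qed.

Definition rect_region (b1 b2 c1 c2 : R) (z : R * R) : bool :=
  (b1 <= z.1 <= b2) && (c1 <= z.2 <= c2).

(** Image of [C2] in pivot coordinates, with the bounds on [u / s] written without division. *)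
Definition wedge_region (r1 r2 c1 c2 : R) (z : R * R) : bool :=
  (r1 * z.2 <= z.1 <= r2 * z.2) && (c1 <= z.1 + z.2 <= c2).

Lemma measurable_rect_region b1 b2 c1 c2 :
  measurable_fun setT (rect_region b1 b2 c1 c2).
Proof.
by apply: measurable_and; apply: measurable_and; apply: measurable_fun_ler => //;
  exact: measurable_cst.
Qed.

Lemma measurable_wedge_region r1 r2 c1 c2 :
  measurable_fun setT (wedge_region r1 r2 c1 c2).
Proof.
have mD : measurable_fun setT (fun z : R * R => z.1 + z.2) by exact: measurable_funD.
have mM (r : R) : measurable_fun setT (fun z : R * R => r * z.2).
  by apply: measurable_funM => //; exact: measurable_cst.
by apply: measurable_and; apply: measurable_and; apply: measurable_fun_ler => //;
  exact: measurable_cst.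
Qed.

Lemma integral_rect_region k (b1 b2 c1 c2 : R) :
  0 < b1 -> b1 <= b2 -> 0 < c1 -> c1 <= c2 ->
  (\int[leb]_u \int[leb]_s
     ((if (0 < u)%R then expR (- u) else 0) * gamma_dens k s *
      (if rect_region b1 b2 c1 c2 (u, s) then 1 else 0))%:E =
  ((expR (- b1) - expR (- b2)) * (gamma_cdf k c2 - gamma_cdf k c1))%:E)%E.
Proof.
move=> b0 b12 c0 c12.
transitivity (\int[leb]_u (if u \in `[b1, b2] then
    ((gamma_cdf k c2 - gamma_cdf k c1) * gamma_kernel 0 u)%:E else 0))%E.
  apply: eq_integral => u _; rewrite /rect_region in_itv/=.
  have [ub|_] := boolP (b1 <= u <= b2); last first.
    by rewrite integral0_eq// => s _; rewrite /= mulr0.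
  have u0 : 0 < u by apply: lt_le_trans b0 _; case/andP: ub.
  rewrite u0 /= mulrC /gamma_kernel expr0 fact0 divr1 mul1r.
  rewrite -integral_gamma_kernelZ//; apply: eq_integral => s _; rewrite in_itv/=.
  case: ifPn => [/andP[cs _]|_]; last by rewrite mulr0.
  by rewrite mulr1 /gamma_dens (le_trans (ltW c0) cs).
rewrite integral_gamma_kernelZ// mulrC; congr (_ * _)%:E.
by rewrite /= /gamma_kernel !expr0 fact0 !divr1 !mul1r; ring.
Qed.

(** Independence of [u / s] and [u + s]: the first exceeds [f] with probability
    [(1 + f)^-1 ^+ k.+1], and the second is Gamma(k+2). *)
Lemma integral_wedge_region k (f1 f2 c1 c2 : R) :
  0 < f1 -> f1 <= f2 -> 0 < c1 -> c1 <= c2 ->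
  (\int[leb]_u \int[leb]_s
     ((if (0 < u)%R then expR (- u) else 0) * gamma_dens k s *
      (if wedge_region f1 f2 c1 c2 (u, s) then 1 else 0))%:E =
  (((1 + f1)^-1 ^+ k.+1 - (1 + f2)^-1 ^+ k.+1) *
    (gamma_cdf k.+1 c2 - gamma_cdf k.+1 c1))%:E)%E.
Proof.
move=> f10 f12 c0 c12; have f20 := lt_le_trans f10 f12.
set D := (1 + f1)^-1 ^+ k.+1 - _.
pose g (z : R * R) := ((if (0 < z.1)%R then expR (- z.1) else 0) * gamma_dens k (z.2 - z.1) *
      (if wedge_region f1 f2 c1 c2 (z.1, z.2 - z.1) then 1 else 0))%:E.
have e0 (u : R) : 0 <= if 0 < u then expR (- u) else 0.
  by case: ifP => // _; exact: expR_ge0.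
have me : measurable_fun setT (fun u : R => if 0 < u then expR (- u) else 0).
  apply: measurable_fun_ifT => //; first by apply: measurable_fun_ltr => //; exact: measurable_cst.
  by apply: (measurableT_comp (@measurable_expR R)); exact: measurable_funN.
have mw : measurable_fun setT (fun z => if wedge_region f1 f2 c1 c2 z then 1 else 0 : R).
  by apply: measurable_fun_ifT => //; exact: measurable_wedge_region.
have w0 z : 0 <= if wedge_region f1 f2 c1 c2 z then 1 else 0 :> R by case: ifP.
have g0 z : (0 <= g z)%E by rewrite lee_fin !mulr_ge0// gamma_dens_ge0.
have mg : measurable_fun setT g.
  have mB : measurable_fun setT (fun z : R * R => z.2 - z.1) by exact: measurable_funB.
  apply/measurable_EFinP; apply: measurable_funM.
    apply: measurable_funM; first exact: (measurableT_comp me).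
    exact: (measurableT_comp (measurable_gamma_dens k)).
  apply: (measurableT_comp mw).
  exact: measurable_fun_pair.
(* Substitute r = u + s: for fixed r the constraint on u/s becomes
   f1/(1+f1) r <= u <= f2/(1+f2) r, and the integral over u is elementary. *)
transitivity (\int[leb]_u \int[leb]_r g (u, r))%E.
  apply: eq_integral => u _.
  rewrite [RHS](@integral_affine _ _ 1 u)//.
  - rewrite mul1e; apply: eq_integral => s _.
    by rewrite /g/= mul1r addrK.
  - exact: (measurableT_comp mg (measurable_pair1 u)).
transitivity (\int[leb]_r \int[leb]_u g (u, r))%E.
  exact: (@fubini_tonelli _ _ _ _ _ leb leb g mg g0).
rewrite -integral_gamma_kernelZ//.
apply: eq_integral => r _; rewrite in_itv/=.
case: ifPn => [/andP[cr rc]|rc]; last first.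
  rewrite integral0_eq// => u _.
  by rewrite /g /wedge_region /= (addrC u) subrK (negbTE rc) andbF mulr0.
have r0 : 0 < r by exact: lt_le_trans cr.
have one f : 0 < f -> 0 < 1 + f by move=> ?; rewrite addr_gt0.
pose al f := f / (1 + f) * r.
have alE f : 0 < f -> r - al f = (1 + f)^-1 * r.
  by move=> fp; rewrite /al; field; rewrite gt_eqF ?one.
have al12 : al f1 <= al f2.
  by rewrite -lerN2 -(lerD2l r) !alE// ler_pM2r// lef_pV2 ?posrE ?one// lerD2l.
(* Since [r - al f] is proportional to [r], the inner integral splits into [D], free of [r], and the
   Gamma(k+2) density. *)
have -> : D * gamma_kernel k.+1 r =
    expR (- r) * ((r - al f1) ^+ k.+1 - (r - al f2) ^+ k.+1) / k.+1`!%:R.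
  by rewrite !alE// !exprMn /D /gamma_kernel; ring.
rewrite -integral_subX// integral_itv_if.
apply: eq_integral => u _; rewrite in_itv/=.
rewrite /g /wedge_region /= (addrC u) subrK cr rc andbT.
have sideE f : 0 < f -> (f * (r - u) <= u) = (al f <= u).
  move=> fp; rewrite /al mulrAC ler_pdivrMr ?one//.
  by rewrite -subr_ge0 -[RHS]subr_ge0; congr (0 <= _); ring.
have sideE' f : 0 < f -> (u <= f * (r - u)) = (u <= al f).
  move=> fp; rewrite /al mulrAC ler_pdivlMr ?one//.
  by rewrite -subr_ge0 -[RHS]subr_ge0; congr (0 <= _); ring.
rewrite sideE// sideE'//.
have [/andP[u1 u2]|_] := boolP (al f1 <= u <= al f2); last by rewrite mulr0.
have u0 : 0 < u by apply: lt_le_trans u1; rewrite /al mulr_gt0// divr_gt0// one.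
have ur : 0 <= r - u.
  by rewrite -(@pmulr_rge0 _ f2)// (le_trans (ltW u0))// sideE'.
rewrite u0 mulr1 /gamma_dens ur /gamma_kernel; congr EFin.
rewrite mulrCA -expRD mulrC; congr (expR _ * _); ring.
Qed.

Section Coverage.
Variables (k : nat) (Rs : nat -> nat).
Local Notation m := k.+2.
Implicit Types (x : m.-tuple R) (th : R * R).

Lemma measurable_nth j : measurable_fun setT (fun x : m.-tuple R => nth 0 x j).
Proof.
have [jm|mj] := ltnP j m.
  rewrite (_ : (fun _ => _) = (fun x : m.-tuple R => tnth x (Ordinal jm))).
    exact: measurable_tnth.
  by apply/funext => x; rewrite (tnth_nth 0).
rewrite (_ : (fun _ => _) = cst 0); first exact: measurable_cst.
by apply/funext => x; rewrite nth_default ?size_tuple.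
Qed.

Lemma measurable_hsig : measurable_fun setT (fun x : m.-tuple R => hsig Rs x).
Proof.
apply: measurable_funM; first exact: measurable_cst.
apply: measurable_sum => j; apply: measurable_funM; first exact: measurable_cst.
by apply: measurable_funB; exact: measurable_nth.
Qed.

(** Coverage of the graph is equivalent to [C x th], which [d] expresses through the pivots. The
    case [hsig Rs x <= 0] must be treated because [x] ranges over all tuples, unsorted ones
    included. *)
Lemma exact_conf_band_of (C : m.-tuple R -> set (R * R))
    (U O : m.-tuple R -> R -> R) lvl :
  (forall x, 0 < hsig Rs x -> band_of (C x) = between (U x) (O x) /\
     forall th, Theta th -> graph (expF th) `<=` between (U x) (O x) -> C x th) ->
  (forall x, hsig Rs x <= 0 -> C x = set0) ->
  (forall th, Theta th -> exists d : R * R -> bool,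
     [/\ measurable_fun setT d,
         forall x, C x th <-> d (gam R m Rs 0 * (hmu x - th.1) / th.2,
                                 m%:R * hsig Rs x / th.2)
       & (\int[leb]_u \int[leb]_s ((if (0 < u)%R then expR (- u) else 0) *
            gamma_dens k s * (if d (u, s) then 1 else 0))%:E = lvl%:E)%E]) ->
  exact_conf_band Rs (fun x => band_of (C x)) lvl.
Proof.
move=> CB C0 Cd th Tth; have [d [md CdE dI]] := Cd th Tth.
pose AS x := (gam R m Rs 0 * (hmu x - th.1) / th.2, m%:R * hsig Rs x / th.2).
have EE : [set x : m.-tuple R | graph (expF th) `<=` band_of (C x)] =
    [set x | d (AS x)].
  apply/seteqP; split=> x /=; rewrite -/(AS x); last first.
    by move=> dx z gz; exists th => //; apply/CdE.
  move=> gB; apply/CdE; have [s0|s0] := ltP 0 (hsig Rs x); last first.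
    move: gB; rewrite C0// /band_of bigcup_set0 => gB.
    by have := gB (0, expF th 0) erefl.
  by have [BE] := CB x s0; apply => //; rewrite -BE.
have mAS : measurable_fun setT AS.
  apply: measurable_fun_pair.
    apply: measurable_funM; last exact: measurable_cst.
    apply: measurable_funM; first exact: measurable_cst.
    by apply: measurable_funB => //; exact: measurable_nth.
  apply: measurable_funM; last exact: measurable_cst.
  by apply: measurable_funM => //; exact: measurable_hsig.
split; [|split].
- rewrite EE.
  rewrite [X in measurable X](_ : _ = setT `&` (d \o AS) @^-1` [set true]).
    exact: (measurableT_comp md mAS).
  by rewrite setTI; apply/seteqP; split=> x.
(* The null set can be empty: for hsig <= 0 the region, hence the band, is empty. *)
- exists set0; split=> //; split.
    rewrite /pc_prob (@eq_iint _ _ _ (fun=> 0%E)) ?iint0// => x.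
    by rewrite indic0 mul0r.
  move=> x _ t y1 y2; have [s0|s0] := ltP 0 (hsig Rs x); last first.
    by rewrite C0// /band_of bigcup_set0.
  have [-> _] := CB x s0; rewrite /between /=.
  move=> [/andP[y10 y11] /andP[Uy1 y1O]] [/andP[y20 y21] /andP[Uy2 y2O]].
  move=> z /andP[y1z zy2].
  rewrite (le_trans y10 y1z) (le_trans zy2 y21) (le_trans Uy1 y1z).
  by rewrite (le_trans zy2 y2O).
- rewrite EE -dI.
  apply: (@pc_prob_law _ _ _ _ _ (fun z => if d z then 1 else 0)) => //.
  + by apply: measurable_fun_ifT.
  + by move=> z; case: ifP.
  + by move=> x; rewrite indicE mem_setE /in_mem /= /AS; case: (d _).
Qed.

End Coverage.
End Bands.

(** * Both regions at the chi-square and F quantiles *)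

Lemma gam0_total (R : realType) n m (Rs : nat -> nat) : (m <= n)%N ->
  (\sum_(i < m) Rs i)%N = (n - m)%N -> gam R m Rs 0 = n%:R.
Proof.
move=> mn sR; rewrite /gam big_mkord; congr (_%:R).
under eq_bigr do rewrite -addn1.
by rewrite big_split /= sum_nat_const card_ord muln1 sR subnK.
Qed.

Unset Implicit Arguments.

Theorem theorem1 (R : realType) (n m : nat) (Rs : nat -> nat) (p : R) :
  (1 < m)%N -> (m <= n)%N -> (\sum_(i < m) Rs i)%N = (n - m)%N ->
  0 < p < 1 ->
  let q1 := (1 - Num.sqrt (1 - p)) / 2 in
  let q2 := 1 - q1 in
  let B1 := fun x : m.-tuple R => band_of (C1 n Rs x q1 q2) in
  let B2 := fun x : m.-tuple R => band_of (C2 n Rs x q1 q2) in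
  (forall x : m.-tuple R, 0 < hsig Rs x ->
     B1 x = between (U1 n Rs x q1 q2) (O1 n Rs x q1 q2) /\
     B2 x = between (U2 n Rs x q1 q2) (O2 n Rs x q1 q2)) /\
  exact_conf_band Rs B1 (1 - p) /\ exact_conf_band Rs B2 (1 - p).
Proof.
move=> m1 mn sR /andP[p0 p1] q1 q2.
have g0 := gam0_total R mn sR.
case: m m1 mn sR g0 => [|[|k]]// _ mn _ g0 B1 B2.
have n0 : 0 < n%:R :> R by rewrite ltr0n; exact: leq_trans mn.
have d0 : 0 < k.+1%:R :> R by rewrite ltr0n.
have m0 : 0 < k.+2%:R :> R by rewrite ltr0n.
have mB1 : k.+2%:R - 1 = k.+1%:R :> R by rewrite -[k.+2%:R]natr1 addrK.
have m2 : (2 * k.+2 - 2 = 2 * k.+1)%N by rewrite mulnS addKn.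
pose r := Num.sqrt (1 - p).
have r0 : 0 < r by rewrite sqrtr_gt0 subr_gt0.
have r2 : r * r = 1 - p by rewrite -expr2 sqr_sqrtr// subr_ge0 ltW.
have r1 : r < 1 by nra.
have q1E : q1 = (1 - r) / 2 by [].
have q10 : 0 < q1 by rewrite q1E; lra.
have q12 : q1 < q2 by rewrite /q2 q1E; lra.
have q21 : q2 < 1 by rewrite /q2; lra.
have q20 : 0 < q2 by exact: lt_trans q12.
have q11 : q1 < 1 by exact: lt_trans q21.
(* Each region imposes two independent conditions of probability [q2 - q1 = r], so the level is
   [r * r]. *)
have q21E : (q2 - q1) * (q2 - q1) = 1 - p by rewrite -r2 /q2 q1E; field.
have q1_01 : 0 < q1 < 1 by rewrite q10.
have q2_01 : 0 < q2 < 1 by rewrite q20.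
have [x10 x1E] := chi2qP (isT : (0 < k.+1)%N) q1_01.
have [x20 x2E] := chi2qP (isT : (0 < k.+1)%N) q2_01.
have x12 := chi2q_lt (isT : (0 < k.+1)%N) q10 q12 q21.
have [y10 y1E] := chi2qP (isT : (0 < k.+2)%N) q1_01.
have [y20 y2E] := chi2qP (isT : (0 < k.+2)%N) q2_01.
have y12 := chi2q_lt (isT : (0 < k.+2)%N) q10 q12 q21.
have [f10 f1E] := FqP (isT : (0 < k.+1)%N) q1_01.
have [f20 f2E] := FqP (isT : (0 < k.+1)%N) q2_01.
have f12 := Fq_lt (isT : (0 < k.+1)%N) q10 q12 q21.
rewrite -m2 in x10 x1E x20 x2E x12 f10 f1E f20 f2E f12.
(* The quantiles become variables: only their signs, their order and their cdf values matter
   below. *)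
have [x1 Ex1] : {z | chi2q (2 * k.+2 - 2) q1 = z} by eexists.
rewrite Ex1 in x10 x1E x12.
have [x2 Ex2] : {z | chi2q (2 * k.+2 - 2) q2 = z} by eexists.
rewrite Ex2 in x20 x2E x12.
have [y1 Ey1] : {z | chi2q (2 * k.+2) q1 = z} by eexists.
rewrite Ey1 in y10 y1E y12.
have [y2 Ey2] : {z | chi2q (2 * k.+2) q2 = z} by eexists.
rewrite Ey2 in y20 y2E y12.
have [f1 Ef1] : {z | Fq 2 (2 * k.+2 - 2) q1 = z} by eexists.
rewrite Ef1 in f10 f1E f12.
have [f2 Ef2] : {z | Fq 2 (2 * k.+2 - 2) q2 = z} by eexists.
rewrite Ef2 in f20 f2E f12.
have ln12 : ln q1 < ln q2 by rewrite ltr_ln.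
have ln2 : ln q2 < 0 by rewrite -ln1 ltr_ln// posrE.
have T1 x : 0 < hsig Rs x ->
    B1 x = between (U1 n Rs x q1 q2) (O1 n Rs x q1 q2) /\
    forall th, Theta th ->
      graph (expF th) `<=` between (U1 n Rs x q1 q2) (O1 n Rs x q1 q2) ->
      C1 n Rs x q1 q2 th.
  move=> s0; apply: (@trapezoid1 R (hmu x) (- ln q1 / n%:R) (- ln q2 / n%:R)).
  - by move=> s; rewrite /a_q; field; rewrite gt_eqF.
  - by move=> s; rewrite /a_q; field; rewrite gt_eqF.
  - by rewrite divr_gt0// oppr_gt0.
  - by rewrite ltr_pM2r ?invr_gt0// ltrN2.
  - rewrite /sig_q Ex2.
    exact: divr_gt0 (mulr_gt0 (mulr_gt0 (ltr0Sn _ _) m0) s0) x20.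
  - rewrite /sig_q Ex1 Ex2 ltr_pM2l; first by rewrite ltf_pV2.
    exact: mulr_gt0 (mulr_gt0 (ltr0Sn _ _) m0) s0.
have T2 x : 0 < hsig Rs x ->
    B2 x = between (U2 n Rs x q1 q2) (O2 n Rs x q1 q2) /\
    forall th, Theta th ->
      graph (expF th) `<=` between (U2 n Rs x q1 q2) (O2 n Rs x q1 q2) ->
      C2 n Rs x q1 q2 th.
  move=> s0; apply: (@trapezoid2 R _ (2 * n%:R / y1) (2 * n%:R / y2)).
  - by move=> mu; rewrite /b_q Ey1; field; rewrite !gt_eqF.
  - by move=> mu; rewrite /b_q Ey2; field; rewrite !gt_eqF.
  - by rewrite divr_gt0// mulr_gt0.
  - by rewrite ltr_pM2l ?mulr_gt0// ltf_pV2.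
  - rewrite /mu_q Ef1 Ef2 mB1 ltrD2l ltrN2 ltr_pM2r ?invr_gt0 ?mulr_gt0//.
    by rewrite ltr_pM2l// mulr_gt0.
  - rewrite (@lt_trans _ _ (hmu x))//.
      by rewrite /mu_q Ef1 mB1 gtrBl divr_gt0// mulr_gt0// mulr_gt0.
    by rewrite ltrDl divr_gt0// mulr_gt0.
split; first by move=> x s0; split; [case: (T1 x s0)|case: (T2 x s0)].
split.
- apply: (exact_conf_band_of T1) => [x s0|th Tth].
    (* If [hsig Rs x <= 0], the upper bound [sig_q] at [q1] is nonpositive, against [Theta]. *)
    apply/seteqP; split=> // -[mu s] [+ [_ /andP[_ +]]].
    rewrite /Theta /sig_q /= Ex1 => s0' ss.
    have : 2 * k.+2%:R * hsig Rs x / x1 <= 0.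
      by rewrite mulr_le0_ge0 ?invr_ge0 ?(ltW x10)// mulr_ge0_le0// mulr_ge0 ?ltW.
    by move=> /(le_trans ss); rewrite leNgt s0'.
  (* The exponential pivot lies between these bounds with probability [q2 - q1]; the halves turn
     chi-square quantiles into gamma quantiles. *)
  exists (rect_region (- ln q2) (- ln q1) (x1 / 2) (x2 / 2)); split.
  + exact: measurable_rect_region.
  + move=> x; rewrite /rect_region /C1 g0 /=.
    have s0 : 0 < th.2 by [].
    rewrite /a_q /sig_q Ex1 Ex2 (ler_pdivrMr _ _ x20) (ler_pdivlMr _ _ x10).
    rewrite !(ler_pdivrMr _ _ s0) !(ler_pdivlMr _ _ s0).
    set S := k.+2%:R * hsig Rs x.
    have -> : 2 * k.+2%:R * hsig Rs x = 2 * S by rewrite /S mulrA.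
    have -> : (th.1 <= hmu x + th.2 * ln q2 / n%:R) =
        (- ln q2 * th.2 <= n%:R * (hmu x - th.1)).
      by rewrite -lerBlDl (ler_pdivlMr _ _ n0) -[LHS]lerN2; congr (_ <= _); ring.
    have -> : (hmu x + th.2 * ln q1 / n%:R <= th.1) =
        (n%:R * (hmu x - th.1) <= - ln q1 * th.2).
      by rewrite -lerBrDl (ler_pdivrMr _ _ n0) -[LHS]lerN2; congr (_ <= _); ring.
    have -> : (2 * S <= th.2 * x2) = (S <= x2 / 2 * th.2).
      by rewrite (mulrAC x2) (ler_pdivlMr _ _ (ltr0Sn _ 1)); congr (_ <= _); ring.
    have -> : (th.2 * x1 <= 2 * S) = (x1 / 2 * th.2 <= S).
      by rewrite (mulrAC x1) (ler_pdivrMr _ _ (ltr0Sn _ 1)); congr (_ <= _); ring.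
    split; first by move=> [_ [/andP[-> ->] /andP[-> ->]]].
    by move=> /andP[/andP[-> ->] /andP[-> ->]].
  + rewrite integral_rect_region ?oppr_gt0 ?divr_gt0//.
    * rewrite !opprK !lnK// x1E x2E; congr EFin.
      by rewrite -q21E.
    * by rewrite lerN2 ltW.
    * by rewrite ler_pM2r ?invr_gt0// ltW.
- apply: (exact_conf_band_of T2) => [x s0|th Tth].
    (* If [hsig Rs x <= 0], then [mu_q] at [q2] is at least [hmu x]. So [hmu x - mu <= 0], and the
       upper bound [b_q] for the scale is nonpositive. *)
    apply/seteqP; split=> // -[mu s] [+ [/andP[+ _] /andP[_ +]]].
    rewrite /Theta /mu_q /b_q /= Ey1 Ef2 mB1 => s0' mm ss.
    have S0 : k.+2%:R * hsig Rs x <= 0 by rewrite mulr_ge0_le0// ltW.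
    have h0 : hmu x - mu <= 0.
      rewrite subr_le0 (le_trans _ mm)// lerDl oppr_ge0.
      by rewrite mulr_le0_ge0 ?invr_ge0 ?mulr_ge0 ?(ltW d0) ?(ltW n0)//
        mulr_le0_ge0// ltW.
    have : 2 * (n%:R * (hmu x - mu) + k.+2%:R * hsig Rs x) / y1 <= 0.
      rewrite mulr_le0_ge0 ?invr_ge0 ?(ltW y10)// mulr_ge0_le0//.
      by rewrite -[leRHS]addr0 lerD// mulr_ge0_le0// ltW.
    by move=> /(le_trans ss); rewrite leNgt s0'.
  (* With [m - 1 = k.+1], the ratio [k.+1 * u / s] has the F distribution with (2, 2m-2) degrees of
     freedom, and [2 * (u + s)] is chi-square with 2m. *)
  exists (wedge_region (f1 / k.+1%:R) (f2 / k.+1%:R) (y1 / 2) (y2 / 2)); split.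
  + exact: measurable_wedge_region.
  + move=> x; rewrite /wedge_region /C2 g0 /=.
    have s0 : 0 < th.2 by [].
    rewrite /mu_q /b_q Ey1 Ey2 Ef1 Ef2 mB1.
    set S := k.+2%:R * hsig Rs x; set A := n%:R * (hmu x - th.1).
    have kn0 : 0 < k.+1%:R * n%:R :> R by exact: mulr_gt0.
    have -> : (hmu x - S * f2 / (k.+1%:R * n%:R) <= th.1) =
        (A / th.2 <= f2 / k.+1%:R * (S / th.2)).
      rewrite lerBlDr -lerBlDl ler_pdivlMr// mulrA ler_pM2r ?invr_gt0//.
      by rewrite (mulrAC f2) (ler_pdivlMr _ _ d0); congr (_ <= _); rewrite /A; ring.
    have -> : (th.1 <= hmu x - S * f1 / (k.+1%:R * n%:R)) =
        (f1 / k.+1%:R * (S / th.2) <= A / th.2).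
      rewrite lerBrDr -lerBrDl ler_pdivrMr// mulrA ler_pM2r ?invr_gt0//.
      by rewrite (mulrAC f1) (ler_pdivrMr _ _ d0); congr (_ <= _); rewrite /A; ring.
    have -> : (2 * (A + S) / y2 <= th.2) = (A / th.2 + S / th.2 <= y2 / 2).
      rewrite -mulrDl (ler_pdivrMr _ _ y20) (ler_pdivrMr _ _ s0) mulrAC.
      by rewrite (ler_pdivlMr _ _ (ltr0Sn _ 1)); congr (_ <= _); ring.
    have -> : (th.2 <= 2 * (A + S) / y1) = (y1 / 2 <= A / th.2 + S / th.2).
      rewrite -mulrDl (ler_pdivlMr _ _ y10) (ler_pdivlMr _ _ s0) mulrAC.
      by rewrite (ler_pdivrMr _ _ (ltr0Sn _ 1)); congr (_ <= _); ring.
    split; first by move=> [_ [/andP[-> ->] /andP[-> ->]]].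
    by move=> /andP[/andP[-> ->] /andP[-> ->]].
  + rewrite integral_wedge_region ?divr_gt0//.
    * rewrite f1E f2E y1E y2E; congr EFin.
      by rewrite -q21E; ring.
    * by rewrite ler_pM2r ?invr_gt0// ltW.
    * by rewrite ler_pM2r ?invr_gt0// ltW.
Qed.
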